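(* Consider the combinatorial causal bandit problem with budget $K$ and horizon $T$ on a binary linear model (BLM) $G=(\boldsymbol U\cup\boldsymbol X\cup\{Y\},E)$ with hidden variables of the admissible form described in the context, and let $G'$ be the transformed Markovian BLM. Suppose Assumption 3 (stated in the context for the parent sets $\mathrm{Pa}'(X)$ of $G'$) holds with constant $\zeta>0$. Then the regret (with respect to $G$) of the algorithm BGLM-OFU run on $G'$ satisfies $$R(T)=O\left(n\sqrt{DT}\,\log T\right),$$ where $n$ is the number of nodes of $G'$ and $D=\max_{X\in\boldsymbol X\cup\{Y\}}|\mathrm{Pa}'(X)|$ is the maximum in-degree in $G'$. (That is, with an absolute implied constant, as $T\to\infty$ for each fixed model.)
   Context: **BLM with hidden variables.** $G=(\boldsymbol U\cup\boldsymbol X\cup\{Y\},E)$ is a finite DAG with $\{0,1\}$-valued variables; $\boldsymbol U=\{U_0,U_1,\dots\}$ are hidden, $\boldsymbol X\cup\{Y\}$ observed; $Y$ has no outgoing edges; $U_0\equiv1$ has only outgoing edges (modelling self-activation). For every node $X\neq U_0$ with parents $\mathrm{Pa}(X)$: $P(X=1\mid \mathrm{Pa}(X)=\mathrm{pa}(X))=\boldsymbol\theta^*_X\cdot \mathrm{pa}(X)+\varepsilon_X\in[0,1]$, with unknown $\boldsymbol\theta^*_X\in[0,1]^{|\mathrm{Pa}(X)|}$ and zero-mean sub-Gaussian noises $\varepsilon_X$, mutually independent over nodes and rounds. $\theta^*_{Z,X}$ is the weight of edge $(Z,X)$. Arbitrary edges involving hidden nodes are allowed, except that the following is excluded: a hidden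 node $U_s$ with $s>0$ has a directed path to an observed $X_i$ and a directed path to an observed descendant $X_j$ of $X_i$, with all nodes of both paths hidden except the end points $X_i$, $X_j$. $do(\boldsymbol S=\boldsymbol s)$ forces $\boldsymbol S$ to values $\boldsymbol s$; $do(\boldsymbol S)$ means $do(\boldsymbol S=\boldsymbol 1)$. **Transformed model $G'$.** $G'=(\{X_1\}\cup\boldsymbol X\cup\{Y\},E')$, with $X_1\notin\boldsymbol X\cup\{Y\}$ a new node constantly equal to $1$. A hidden path from observed $X_i$ to observed $X_j$ in $G$ is a directed path all of whose intermediate nodes (if any) are hidden; $\theta^*_P$ is the product of the weights on path $P$. If the set $\mathcal P^u_{X_i,X_j}$ of hidden paths is nonempty, $E'$ contains $(X_i,X_j)$ with weight $\theta^{*\prime}_{X_i,X_j}=\sum_{P\in\mathcal P^u_{X_i,X_j}}\theta^*_P$. For each $X_i\in\boldsymbol X\cup\{Y\}$, $E'$ contains $(X_1,X_i)$ with weight $\theta^{*\prime}_{X_1,X_i}=\Pr\{X_i=1\mid do(\boldsymbol X\cup\{Y\}\setminus\{X_i\}=\boldsymbol0)\}$ (probability in $G$). The noise variables are carried over; $G'$ is a BLM without hidden variables. $\mathrm{Pa}'(X)$ denotes parents in $G'$. $\sigma'(\boldsymbol S,\boldsymbol\theta)$ is the expectation of $Y$ under $do(\boldsymbol S)$ in $G'$ when its parameters are $\boldsymbol\theta$, where, in topological order, a non-intervened $X$ is set to $1$ iff $\boldsymbol\theta_X\cdot \mathrm{Pa}'(X)+\varepsilon_X\ge\gamma_X$ with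 $\gamma_X$ i.i.d. uniform on $[0,1]$. **Problem.** In each round $t=1,\dots,T$ the agent chooses $\boldsymbol S_t\subseteq\boldsymbol X$, $|\boldsymbol S_t|\le K$, plays $do(\boldsymbol S_t)$ in $G$, and observes all values of $\boldsymbol X\cup\{Y\}$. The observed graph structure is known; the parameters are not. $R(T)=\mathbb E[\sum_{t=1}^T(\mathbb E[Y\mid do(\boldsymbol S^* )]-\mathbb E[Y\mid do(\boldsymbol S_t)])]$, where $\boldsymbol S^*$ maximizes $\mathbb E[Y\mid do(\boldsymbol S)]$ over $\boldsymbol S\subseteq\boldsymbol X$, $|\boldsymbol S|=K$. **Assumption 3 (for $G'$).** There is $\zeta>0$ such that for every $X\in\boldsymbol X\cup\{Y\}$, every $X'\in \mathrm{Pa}'(X)\setminus\{X_1\}$ and every $\boldsymbol v\in\{0,1\}^{|\mathrm{Pa}'(X)\setminus\{X',X_1\}|}$, with no intervention, $\Pr\{X'=b\mid \mathrm{Pa}'(X)\setminus\{X',X_1\}=\boldsymbol v\}\ge\zeta$ for $b=0,1$. **Algorithm BGLM-OFU on $G'$.** $\|\boldsymbol x\|_M=\sqrt{\boldsymbol x^\top M\boldsymbol x}$. Here the link functions are identities, with $L^{(1)}=\kappa=1$ and $L^{(2)}$ any fixed positive constant. Let $c>0$ be an absolute constant for which the Lecué–Mendelson inequality holds: if $\boldsymbol v_1,\dots,\boldsymbol v_k$ are i.i.d. copies of $\boldsymbol v\in\mathbb R^d$ with $\Pr\{|\boldsymbol v^\top\boldsymbol z|>\alpha^{1/2}\}\ge\beta$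 for all unit $\boldsymbol z$ ($\alpha\ge0$, $0<\beta\le1$) and $k\ge cd/\beta^2$, then $\Pr\{\lambda_{\min}(\frac1k\sum_i\boldsymbol v_i\boldsymbol v_i^\top)\le\alpha\beta/2\}\le\exp(-k\beta^2/c)$. Set $\delta=\frac1{3n\sqrt T}$, $R=\lceil512D(L^{(2)})^2(D^2+\ln\frac1\delta)\rceil$, $T_0=\lceil\max\{\frac c{\zeta^2}\ln\frac1\delta,\frac{(8n^2-16n+2)R}{\zeta}\}\rceil$, $\rho=3\sqrt{\log(1/\delta)}$. No intervention in rounds $1,\dots,T_0$. In each round $t>T_0$, for each $X\in\boldsymbol X\cup\{Y\}$ use the data $(\boldsymbol V_{i,X},X^i)$ from rounds $i\le t-1$ with $X\notin\boldsymbol S_i$ ($\boldsymbol V_{i,X}$: values of $\mathrm{Pa}'(X)$, $X^i$: value of $X$ in round $i$); let $\hat{\boldsymbol\theta}_{t-1,X}$ solve $\sum_i(X^i-\boldsymbol V_{i,X}^\top\boldsymbol\theta_X)\boldsymbol V_{i,X}=0$, $M_{t-1,X}=\sum_i\boldsymbol V_{i,X}\boldsymbol V_{i,X}^\top$, $\mathcal C_{t,X}=\{\boldsymbol\theta'_X\in[0,1]^{|\mathrm{Pa}'(X)|}:\|\boldsymbol\theta'_X-\hat{\boldsymbol\theta}_{t-1,X}\|_{M_{t-1,X}}\le\rho\}$; choose $(\boldsymbol S_t,\tilde{\boldsymbol\theta}_t)$ maximizing $\sigma'(\boldsymbol S,\boldsymbol\theta')$ over $\boldsymbol S\subseteq\boldsymbol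 X$, $|\boldsymbol S|\le K$, $\boldsymbol\theta'_X\in\mathcal C_{t,X}$, and play $do(\boldsymbol S_t)$. *)

(* Defs.v *)
From HB Require Import structures.
From mathcomp Require Import all_boot all_order all_algebra.
From mathcomp Require Import all_classical all_reals all_analysis.

Set Implicit Arguments.
Unset Strict Implicit.
Unset Printing Implicit Defensive.

Import Order.TTheory GRing.Theory Num.Theory.
Import numFieldNormedType.Exports.

Local Open Scope classical_set_scope.
Local Open Scope ring_scope.

(* Mutual independence of the random elements [X i], [i] in [D]: the product
   rule holds for every finite subfamily (and all measurable sets). *)
Definition mutually_independent (R : realType) d (Omega : measurableType d)
    (P : probability Omega R) (I : choiceType) (D : set I)
    d' (T : measurableType d') (X : I -> {RV P >-> T}) : Prop :=
  forall (J : seq I) (B : I -> set T), uniq J -> (forall i, i \in J -> D i) ->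
    (forall i, measurable (B i)) ->
    P (\bigcap_(i in [set` J]) (X i @^-1` B i)) =
    (\prod_(i <- J) P (X i @^-1` B i))%E.

Definition same_law (R : realType) d (Omega : measurableType d)
    (P : probability Omega R) d' (T : measurableType d')
    (X Z : {RV P >-> T}) : Prop :=
  forall B : set T, measurable B -> distribution P X B = distribution P Z B.

Definition sub_gaussian (R : realType) d (Omega : measurableType d)
    (P : probability Omega R) (X : {RV P >-> R}) : Prop :=
  exists2 s : R, 0 < s &
    forall r : R, ('M_P X r <= (expR (s ^+ 2 * r ^+ 2 / 2))%:E)%E.

(* [U] indexes the hidden nodes, [X] the observed nodes other than [Y];
   [inr None] is [Y]. *)
Definition obs (X : finType) : finType := option X.
Definition node (U X : finType) : finType := (U + obs X)%type.
Definition hidden_node (U X : finType) (u : U) : node U X := inl u.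
Definition obs_node (U X : finType) (x : obs X) : node U X := inr x.

(* [hid0] is the hidden node constantly equal to 1. [noise t v] and
   [thresh t v] are the noise and the uniform threshold of node [v] in round
   [t]. The rounds that are played are numbered from 1; round 0 is a copy
   which serves to write the quantities that do not depend on the round, such
   as the expectation of [Y] under an intervention. *)
Record blm (R : realType) d (Omega : measurableType d)
    (P : probability Omega R) (U X : finType) := Blm {
  hid0 : U;
  edge : rel (node U X);
  weight : node U X -> node U X -> R;
  noise : nat -> node U X -> {RV P >-> R};
  thresh : nat -> node U X -> {RV P >-> R} }.

(* [None] leaves the node alone, [Some b] forces it to the value [b]. *)
Definition intervention (X : finType) := obs X -> option bool.

Definition do_ones (X : finType) (S : {set X}) : intervention X :=
  fun x => if x is Some z then (if z \in S then Some true else None) else None.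

Definition do_zeros_but (X : finType) (x : obs X) : intervention X :=
  fun y => if y == x then None else Some false.

Section Model.
Context (R : realType) d (Omega : measurableType d) (P : probability Omega R).
Context (U X : finType) (m : blm P U X).

Local Notation gnode := (node U X).
Local Notation u0 := (@hidden_node U X (hid0 m)).

Definition linear_part (v : gnode) (s : gnode -> bool) : R :=
  \sum_(w | edge m w v) weight m w v * (s w)%:R.

Definition structural_step (iv : intervention X) (t : nat) (w : Omega)
    (s : gnode -> bool) (v : gnode) : bool :=
  let free := thresh m t v w <= linear_part v s + noise m t v w in
  match v with
  | inl u => (u == hid0 m) || free
  | inr x => if iv x is Some b then b else free
  end.

(* In an acyclic graph this is the unique solution of the structural
   equations; the assignment the iteration starts from is irrelevant. *)
Definition blm_value (iv : intervention X) (t : nat) (w : Omega) :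
    gnode -> bool :=
  iter #|gnode| (structural_step iv t w) xpredT.

Definition obs_value iv t w (x : obs X) : bool := blm_value iv t w (obs_node U x).

Definition expected_Y (S : {set X}) : R :=
  fine ('E_P[fun w => (obs_value (do_ones S) 0 w None)%:R%R])%E.

(* Hidden paths. In an acyclic graph a path is simple, so that [#|U|] bounds
   the number of its intermediate (hidden) nodes [p]. *)
Definition is_hidden_path (a : gnode) (p : seq U) (x : obs X) : bool :=
  path (edge m) a (rcons (map (@hidden_node U X) p) (obs_node U x)).

Definition has_hidden_path (a : gnode) (x : obs X) : bool :=
  [exists k : 'I_#|U|.+1, [exists p : k.-tuple U, is_hidden_path a p x]].

Fixpoint path_weight (a : gnode) (p : seq gnode) : R :=
  if p is b :: q then weight m a b * path_weight b q else 1.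

Definition hidden_paths_weight (a : gnode) (x : obs X) : R :=
  \sum_(k < #|U|.+1) \sum_(p : k.-tuple U | is_hidden_path a p x)
    path_weight a (rcons (map (@hidden_node U X) p) (obs_node U x)).

Record valid_blm : Prop := ValidBlm {
  blm_acyclic : forall v w, edge m v w -> ~~ connect (edge m) w v;
  blm_Y_sink : forall v, ~~ edge m (obs_node U None) v;
  blm_hid0_source : forall v, ~~ edge m v u0;
  blm_weight01 : forall v w, edge m v w -> 0 <= weight m v w <= 1;
  blm_prob01 : forall t v, v != u0 ->
    {ae P, forall w, forall s : gnode -> bool, s u0 ->
       0 <= linear_part v s + noise m t v w <= 1};
  blm_noise_mean : forall t v, v != u0 -> ('E_P[noise m t v] = 0)%E;
  blm_noise_tail : forall t v, v != u0 -> sub_gaussian (noise m t v);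
  blm_noise_law : forall t v, v != u0 -> same_law (noise m t v) (noise m 0 v);
  blm_thresh_law : forall t v, v != u0 -> forall B : set R, measurable B ->
    distribution P (thresh m t v) B = uniform_prob (@ltr01 R) B;
  (* the noises and the thresholds of all nodes but [hid0] in all rounds *)
  blm_independent : mutually_independent
    [set i : bool * (nat * gnode) | i.2.2 != u0]
    (fun i => if i.1 then noise m i.2.1 i.2.2 else thresh m i.2.1 i.2.2);
  blm_admissible : forall (u : U) (x y : obs X), u != hid0 m -> x != y ->
    connect (edge m) (obs_node U x) (obs_node U y) ->
    ~~ (has_hidden_path (hidden_node X u) x &&
        has_hidden_path (hidden_node X u) y) }.

(* Nodes of the transformed graph: [None] is the constant node. *)
Definition tnode : finType := option (obs X).

Definition tpar (x : obs X) : {set tnode} :=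
  [set z : tnode | if z is Some y then has_hidden_path (obs_node U y) x
                   else true].

Definition tweight (z : tnode) (x : obs X) : R :=
  if z is Some y then hidden_paths_weight (obs_node U y) x
  else fine (P [set w | obs_value (do_zeros_but x) 0 w x]).

Definition tparams := forall x : obs X, 'cV[R]_#|tpar x|.

Definition true_tparams : tparams :=
  fun x => \col_j tweight (enum_val j) x.

Definition with_one (s : obs X -> bool) (z : tnode) : bool :=
  if z is Some y then s y else true.

Definition par_vec (x : obs X) (s : obs X -> bool) : 'cV[R]_#|tpar x| :=
  \col_(j < #|tpar x|) (with_one s (enum_val j))%:R.

Definition dotv n (a b : 'cV[R]_n) : R := (a^T *m b) 0 0.

(* The transformed model carries over the noises and thresholds of the observed
   nodes; [th] need not be the true parameter, so that the sum below may leave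
   [0, 1]. *)
Definition tstep (th : tparams) (S : {set X}) (w : Omega)
    (s : obs X -> bool) (x : obs X) : bool :=
  if do_ones S x is Some b then b else
    thresh m 0 (obs_node U x) w
      <= dotv (th x) (par_vec x s) + noise m 0 (obs_node U x) w.

Definition tvalue (th : tparams) (S : {set X}) (w : Omega) : obs X -> bool :=
  iter #|obs X| (tstep th S w) xpredT.

Definition sigma' (S : {set X}) (th : tparams) : R :=
  fine ('E_P[fun w => (tvalue th S w None)%:R%R])%E.

Definition tnum : nat := #|tnode|.
Definition tdeg : nat := \max_(x : obs X) #|tpar x|.

(* The probabilities are those of the transformed model without intervention;
   the conditional probability reads 0 when the condition has probability 0
   (the hypothesis forces every condition to have positive probability). *)
Definition assumption3 (zeta : R) : Prop :=
  forall (x y : obs X) (v : tnode -> bool) (b : bool), Some y \in tpar x ->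
  let val w := with_one (tvalue true_tparams finset.set0 w) in
  let rest := [set w | forall z : tnode, z \in tpar x ->
                 z != Some y -> z != None -> val w z = v z] in
  zeta <= fine (P ([set w | val w (Some y) = b] `&` rest)) / fine (P rest).

(* One entry per round played: the intervened set and the observed values. *)
Definition history := seq ({set X} * {ffun obs X -> bool}).
Definition policy := history -> {set X}.

(* history after [t] rounds; [pol (run pol t w)] is played in round [t.+1] *)
Fixpoint run (pol : policy) (t : nat) (w : Omega) : history :=
  if t is t'.+1 then
    let h := run pol t' w in
    rcons h (pol h, [ffun x => obs_value (do_ones (pol h)) t w x])
  else [::].

Definition regret (Sopt : {set X}) (pol : policy) (T : nat) : \bar R :=
  ('E_P[fun w => (\sum_(t < T)
     (expected_Y Sopt - expected_Y (pol (run pol t w))))%R])%E.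

Definition is_optimal (K : nat) (Sopt : {set X}) : Prop :=
  #|Sopt| = K /\
  forall S : {set X}, #|S| = K -> expected_Y S <= expected_Y Sopt.

(* rounds in which [x] is not intervened *)
Definition free_in (x : obs X) (r : {set X} * {ffun obs X -> bool}) : bool :=
  do_ones r.1 x == None.

Definition gram (h : history) (x : obs X) : 'M[R]_#|tpar x| :=
  \sum_(r <- h | free_in x r) par_vec x r.2 *m (par_vec x r.2)^T.

Definition solves_score (h : history) (x : obs X) (th : 'cV[R]_#|tpar x|) :
    Prop :=
  \sum_(r <- h | free_in x r)
    ((r.2 x)%:R - dotv (par_vec x r.2) th) *: par_vec x r.2 = 0.

Definition mnorm n (M : 'M[R]_n) (a : 'cV[R]_n) : R :=
  Num.sqrt ((a^T *m M *m a) 0 0).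

Definition in_confidence (h : history) (rho : R) (hat th : tparams) : Prop :=
  forall x : obs X, (forall j, 0 <= th x j 0 <= 1) /\
    mnorm (gram h x) (th x - hat x) <= rho.

Definition conf_delta (T : nat) : R := (3 * tnum%:R * Num.sqrt T%:R)^-1.

Definition min_eig (L2 : R) (T : nat) : R :=
  (Num.ceil (512 * tdeg%:R * L2 ^+ 2 *
             (tdeg%:R ^+ 2 + ln (conf_delta T)^-1)))%:~R.

Definition init_rounds (c L2 zeta : R) (T : nat) : int :=
  Num.ceil (Num.max (c / zeta ^+ 2 * ln (conf_delta T)^-1)
    ((8 * tnum%:R ^+ 2 - 16 * tnum%:R + 2) * min_eig L2 T / zeta)).

Definition conf_radius (T : nat) : R := 3 * Num.sqrt (ln (conf_delta T)^-1).

(* [pol] is a run of BGLM-OFU with horizon [T]: the choices the algorithm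
   leaves open (a solution of the score equations, a maximizer) may be made in
   any way. If the confidence region contains no parameter at all, the action
   is only required to meet the budget. *)
Definition bglm_ofu (c L2 zeta : R) (K T : nat) (pol : policy) : Prop :=
  forall h : history, (size h < T)%N ->
    if (size h).+1%:Z <= init_rounds c L2 zeta T then pol h = finset.set0
    else (#|pol h| <= K)%N /\
      exists2 hat : tparams, (forall x, solves_score h (hat x)) &
        (exists th, in_confidence h (conf_radius T) hat th) ->
        exists2 opt : tparams, in_confidence h (conf_radius T) hat opt &
          forall (S : {set X}) (th : tparams), (#|S| <= K)%N ->
            in_confidence h (conf_radius T) hat th ->
            sigma' S th <= sigma' (pol h) opt.

End Model.

Definition vec_of_tuple (R : realType) p (v : p.-tuple R) : 'cV[R]_p :=
  \col_j tnth v j.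

(* the smallest eigenvalue when [M] is symmetric and [0 < p] *)
Definition lambda_min (R : realType) p (M : 'M[R]_p) : R :=
  inf [set a : R | eigenvalue M a].

Definition lecue_mendelson (R : realType) (c : R) : Prop :=
  forall (d : measure_display) (Omega : measurableType d)
    (P : probability Omega R) (p k : nat)
    (V : 'I_k -> {RV P >-> p.-tuple R}) (alpha beta : R),
  (0 < p)%N -> 0 <= alpha -> 0 < beta <= 1 ->
  mutually_independent [set: 'I_k] V ->
  (forall i j, same_law (V i) (V j)) ->
  (forall (i : 'I_k) (z : 'cV[R]_p), dotv z z = 1 ->
     (beta%:E <=
      P [set w | (Num.sqrt alpha < `|dotv (vec_of_tuple (V i w)) z|)%R])%E) ->
  c * p%:R / beta ^+ 2 <= k%:R ->
  (P [set w | (lambda_min (k%:R^-1 *: \sum_(i < k)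
        (vec_of_tuple (V i w) *m (vec_of_tuple (V i w))^T))
      <= alpha * beta / 2)%R]
   <= (expR (- (k%:R * beta ^+ 2 / c)))%:E)%E.

(* Main.v *)
Require Import Defs.
From mathcomp Require Import all_boot all_order all_algebra.
From mathcomp Require Import all_classical all_reals all_analysis.
From mathcomp Require Import measurable_realfun.
From mathcomp Require Import ring lra zify.

(* For a fixed model there are finitely many interventions, so a regret bound
   that is polylogarithmic in [T], with constants depending on the model, is
   enough: it is eventually below [sqrt T].

   A node acts through its response function (which states of its parents
   switch it on), a random element of a finite set; these elements are
   independent over nodes and rounds, so all expectations are finite sums.
   Means are linear along edges, and eliminating the hidden nodes gives the
   weights of the transformed model, hence
   [sigma' S true_tparams = expected_Y S]. By admissibility the same
   elimination holds conditionally on the values of the parents of [x], so the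
   regression noises are martingale differences.

   The squared distance of a solution of the score equation to the truth, in
   the Gram norm, is at most the sum over the configurations [c] of the parents
   of [S_c^2 / N_c], where [N_c] counts the visits of [c] and [S_c] sums the
   noises there. Mixing the exponential supermartingales of [S_c] over a dyadic
   grid of tilts, whose size is polylogarithmic in [T], shows that the truth
   leaves the confidence region with probability at most polylog(T) / T.

   When the truth is in the region, optimism allows a suboptimal [S] only if
   some outcome [o] of [do S] of positive probability was seen fewer than
   [O(ln T)] times under [do S]: otherwise every parameter of the region
   predicts almost exactly on all outcomes, and then [sigma' S] is almost at
   most [expected_Y S]. A play of [S] shows [o] with a fixed probability,
   independently of the past, so [O(ln T)] such rounds are expected. *)

Set Implicit Arguments.
Unset Strict Implicit.
Unset Printing Implicit Defensive.

Import Order.TTheory GRing.Theory Num.Theory.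
Import numFieldNormedType.Exports.

Local Open Scope classical_set_scope.
Local Open Scope ring_scope.

(** * Finite product expectations and acyclic structural models *)

Section ProductExpectation.
Context {R : realType} {I F : finType}.
Implicit Types (p : F -> R) (mu : I -> F -> R) (g : {ffun I -> F} -> R).

Definition is_pmf p := (forall b, 0 <= p b) /\ \sum_b p b = 1.

Definition prodE mu g := \sum_(z : {ffun I -> F}) (\prod_i mu i (z i)) * g z.

Definition upd (z : {ffun I -> F}) i b : {ffun I -> F} :=
  [ffun j => if j == i then b else z j].

Lemma eq_prodE mu g h : g =1 h -> prodE mu g = prodE mu h.
Proof. by move=> gh; apply: eq_bigr => z _; rewrite gh. Qed.

Lemma prodED mu g h : prodE mu (fun z => g z + h z) = prodE mu g + prodE mu h.
Proof. by rewrite /prodE -big_split; apply: eq_bigr => z _; rewrite mulrDr. Qed.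

Lemma prodEZ mu c g : prodE mu (fun z => c * g z) = c * prodE mu g.
Proof. by rewrite /prodE big_distrr; apply: eq_bigr => z _; rewrite /= mulrCA. Qed.

Lemma prodE_sum mu (J : finType) (Q : pred J) (g : J -> {ffun I -> F} -> R) :
  prodE mu (fun z => \sum_(j | Q j) g j z) = \sum_(j | Q j) prodE mu (g j).
Proof.
rewrite /prodE exchange_big; apply: eq_bigr => z _; by rewrite big_distrr.
Qed.

Section Probability.
Context (mu : I -> F -> R).
Hypothesis mu_pmf : forall i, is_pmf (mu i).

Lemma prod_pmf_ge0 (z : {ffun I -> F}) : 0 <= \prod_i mu i (z i).
Proof. by apply: prodr_ge0 => i _; case: (mu_pmf i). Qed.

Lemma ler_prodE g h :
  (forall z : {ffun I -> F}, 0 < \prod_i mu i (z i) -> g z <= h z) -> prodE mu g <= prodE mu h.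
Proof.
move=> gh; apply: ler_sum => z _.
have := prod_pmf_ge0 z; rewrite le_eqVlt => /predU1P[<-|z0]; first by rewrite !mul0r.
by rewrite ler_pM2l// gh.
Qed.

Lemma eq_prodE_supp g h :
  (forall z : {ffun I -> F}, 0 < \prod_i mu i (z i) -> g z = h z) -> prodE mu g = prodE mu h.
Proof.
by move=> gh; apply/eqP; rewrite eq_le !ler_prodE// => z /gh ->.
Qed.

Lemma prodE1 : prodE mu (fun=> 1) = 1.
Proof.
rewrite /prodE (eq_bigr (fun z : {ffun I -> F} => \prod_i mu i (z i))); last first.
  by move=> z _; rewrite mulr1.
rewrite -(bigA_distr_bigA (fun i b => mu i b)) big1// => i _.
by case: (mu_pmf i).
Qed.

Lemma prodE_cst c : prodE mu (fun=> c) = c.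
Proof.
by rewrite (eq_prodE _ (h := fun=> c * 1)) ?prodEZ ?prodE1 ?mulr1// => z; rewrite mulr1.
Qed.

Lemma prodE_resample i g :
  prodE mu g = prodE mu (fun z => \sum_b mu i b * g (upd z i b)).
Proof.
pose w (z : {ffun I -> F}) := \prod_(j | j != i) mu j (z j).
have wE (z : {ffun I -> F}) : \prod_j mu j (z j) = mu i (z i) * w z by rewrite /w (bigD1 i).
have wu (z : {ffun I -> F}) b : w (upd z i b) = w z.
  by apply: eq_bigr => j /negbTE ji; rewrite ffunE ji.
transitivity (\sum_(z : {ffun I -> F}) \sum_b mu i b * (\prod_j mu j (z j) * g z)).
  apply: eq_bigr => z _; rewrite -big_distrl/=.
  by case: (mu_pmf i) => _ ->; rewrite mul1r.
transitivity (\sum_(z : {ffun I -> F}) \sum_b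
    \prod_j mu j (z j) * (mu i b * g (upd z i b))); last first.
  by apply: eq_bigr => z _; rewrite big_distrr.
rewrite !pair_bigA/=.
pose f (q : {ffun I -> F} * F) := (upd q.1 i q.2, q.1 i).
have fK : involutive f.
  move=> [z b]; rewrite /f/=; congr pair; last by rewrite ffunE eqxx.
  by apply/ffunP => j; rewrite !ffunE; case: eqP => [->|].
rewrite (reindex_inj (inv_inj fK)) /=; apply: eq_bigr => -[z b] _ /=.
by rewrite !wE wu ffunE eqxx; ring.
Qed.

(** Fubini in one coordinate: moving the dependence on [z i] into the first argument of [h] lets
    [z i] be averaged out while the other coordinates stay fixed. *)
Lemma prodE_upd i g : (forall z b, g (upd z i b) = g z) ->
  forall h : F -> {ffun I -> F} -> R,
  (forall b z c, h b (upd z i c) = h b z) ->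
  prodE mu (fun z => h (z i) z * g z) =
  prodE mu (fun z => (\sum_b mu i b * h b z) * g z).
Proof.
move=> gu h hu; rewrite (prodE_resample i); apply: eq_prodE => z.
by rewrite big_distrl; apply: eq_bigr => b _ /=; rewrite hu gu ffunE eqxx mulrA.
Qed.

End Probability.
End ProductExpectation.

Section Acyclic.
Context {V : finType} (e : rel V).
Hypothesis acyc : forall v w, e v w -> ~~ connect e w v.

(** The number of ancestors of [v], itself included. It strictly increases along edges and so
    provides a topological order. *)
Definition rank v := #|[pred w | connect e w v]|.

Lemma rank_gt0 v : (0 < rank v)%N.
Proof. by apply/card_gt0P; exists v; rewrite inE. Qed.

Lemma rank_le v : (rank v <= #|V|)%N.
Proof. exact: max_card. Qed.

Lemma edge_rank w v : e w v -> (rank w < rank v)%N.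
Proof.
move=> wv; apply: proper_card; apply/fintype.properP; split.
  by apply/fintype.subsetP => x; rewrite !inE => /connect_trans; apply; exact: connect1.
by exists v; rewrite !inE // acyc.
Qed.

(** After as many steps as its rank a node has its final value, since its parents had theirs one
    step earlier; the starting assignment is forgotten by then. *)
Lemma iter_stable (f : (V -> bool) -> V -> bool) :
  (forall s s' v, (forall w, e w v -> s w = s' w) -> f s v = f s' v) ->
  forall k l s s' v, (rank v <= k)%N -> (rank v <= l)%N ->
  iter k f s v = iter l f s' v.
Proof.
move=> floc k l s s' v; move: {2}(rank v) (leqnn (rank v)) k l => n.
elim: n v => [|n IHn] v; first by rewrite leqn0 => /eqP v0; have := rank_gt0 v; rewrite v0.
move=> vn [|k] [|l]; rewrite ?leqn0 => vk vl;
  try by have := rank_gt0 v; rewrite ?(eqP vk) ?(eqP vl).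
rewrite !iterS; apply: floc => w wv; have := edge_rank wv => rwv.
by apply: IHn; rewrite -ltnS; apply: leq_trans rwv _.
Qed.

Lemma iter_fix (f : (V -> bool) -> V -> bool) :
  (forall s s' v, (forall w, e w v -> s w = s' w) -> f s v = f s' v) ->
  forall s v, iter #|V| f s v = f (iter #|V| f s) v.
Proof.
move=> floc s v; rewrite -iterS.
by apply: iter_stable => //; rewrite ?leqW// rank_le.
Qed.

Lemma rank_ind (Q : V -> Prop) :
  (forall v, (forall w, e w v -> Q w) -> Q v) -> forall v, Q v.
Proof.
move=> IH v; move: {2}(rank v) (leqnn (rank v)) => n.
elim: n v => [|n IHn] v vn; apply: IH => w /edge_rank wv.
  by move: (leq_trans wv vn).
by apply: IHn; rewrite -ltnS (leq_trans wv).
Qed.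

End Acyclic.

Section StructuralModel.
Context {R : realType} {V : finType} (e : rel V) (iv : V -> option bool).
Hypothesis acyc : forall v w, e v w -> ~~ connect e w v.

(** A response takes an assignment of all nodes, so that every node has the same finite type of
    responses; [parmask] erases the values of the non-parents. *)
Definition response := {ffun {ffun V -> bool} -> bool}.

Definition parmask v (s : V -> bool) : {ffun V -> bool} := [ffun w => e w v && s w].

Definition scm_step (z : {ffun V -> response}) (s : V -> bool) (v : V) : bool :=
  if iv v is Some b then b else z v (parmask v s).

Definition scm_val z : V -> bool := iter #|V| (scm_step z) xpredT.

Lemma eq_parmask v s s' : (forall w, e w v -> s w = s' w) -> parmask v s = parmask v s'.
Proof. by move=> ss; apply/ffunP => w; rewrite !ffunE; case: (boolP (e w v)) => //= /ss. Qed.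

Lemma scm_step_local z s s' v :
  (forall w, e w v -> s w = s' w) -> scm_step z s v = scm_step z s' v.
Proof. by move=> ss; rewrite /scm_step; case: (iv v) => //; rewrite (eq_parmask ss). Qed.

Lemma scm_valE z v :
  scm_val z v = if iv v is Some b then b else z v (parmask v (scm_val z)).
Proof. exact: (iter_fix acyc (@scm_step_local z)). Qed.

Lemma scm_val_forced z v b : iv v = Some b -> scm_val z v = b.
Proof. by move=> ivb; rewrite scm_valE ivb. Qed.

Lemma scm_val_free z v : iv v = None -> scm_val z v = z v (parmask v (scm_val z)).
Proof. by move=> ivb; rewrite scm_valE ivb. Qed.

Lemma scm_val_upd z v b w : ~~ connect e v w -> scm_val (upd z v b) w = scm_val z w.
Proof.
elim/(rank_ind acyc): w => w IH vw; rewrite !scm_valE; case: (iv w) => //.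
rewrite ffunE; case: eqP => [wv|_]; first by rewrite wv connect0 in vw.
rewrite (@eq_parmask w _ (scm_val z))// => x xw; apply: IH => //.
by apply: contra vw => /connect_trans; apply; exact: connect1.
Qed.

Lemma parmask_upd z v b : parmask v (scm_val (upd z v b)) = parmask v (scm_val z).
Proof. by apply: eq_parmask => w wv; rewrite scm_val_upd// acyc. Qed.

Definition resp_mean (p : response -> R) (s : {ffun V -> bool}) : R :=
  \sum_b p b * (b s)%:R.

(** By acyclicity the values of the parents of [v] do not depend on the response of [v], which can
    therefore be averaged out first. *)
Lemma scm_mean (mu : V -> response -> R) v (g : {ffun V -> response} -> R) :
  (forall v, is_pmf (mu v)) -> iv v = None ->
  (forall z b, g (upd z v b) = g z) ->
  prodE mu (fun z => (scm_val z v)%:R * g z) =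
  prodE mu (fun z => resp_mean (mu v) (parmask v (scm_val z)) * g z).
Proof.
move=> mup ivv gu.
pose h (b : response) (z : {ffun V -> response}) : R := (b (parmask v (scm_val z)))%:R.
rewrite (eq_prodE _ (h := fun z => h (z v) z * g z)); last first.
  by move=> z; rewrite /h -scm_val_free.
by rewrite (prodE_upd mup)// => b z c; rewrite /h parmask_upd.
Qed.

End StructuralModel.

(** * Independent blocks of random variables *)

Definition rectangle {d1 d2} {T1 : measurableType d1} {T2 : measurableType d2}
    (C : set (T1 * T2)) :=
  exists A B, [/\ measurable A, measurable B & C = A `*` B].

(** Rectangles are stable under intersection and generate the product sigma-algebra. *)
Lemma eq_measure_rectangle {R : realType} {d1 d2} {T1 : measurableType d1}
    {T2 : measurableType d2} (m1 m2 : {measure set (T1 * T2) -> \bar R}) :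
  (m1 setT < +oo)%E -> (forall C, rectangle C -> m1 C = m2 C) ->
  forall C, measurable C -> m1 C = m2 C.
Proof.
move=> m1oo m12 C mC.
apply: (measure_unique rectangle (fun=> setT)) => //.
- rewrite measurable_prod_measurableType //; congr (<<s _ >>).
  rewrite predeqE; split => [[A mA [B mB <-]]|[A [B [mA mB ->]]]].
    by exists A, B.
  by exists A => //; exists B.
- move=> _ _ [A1 [B1 [mA1 mB1 ->]]] [A2 [B2 [mA2 mB2 ->]]].
  rewrite -setXI; exists (A1 `&` A2), (B1 `&` B2).
  by split => //; exact: measurableI.
- by move=> _; exists setT, setT; rewrite setXTT.
- by rewrite bigcup_const//; exists 0%N.
Qed.

Section Blocks.
Context {R : realType} {d} {Omega : measurableType d} {P : probability Omega R}.
Context {I : choiceType} (D : set I) (a b : I -> {RV P >-> R}).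
Hypothesis indep : mutually_independent [set i : bool * I | D i.2]
  (fun i => if i.1 then a i.2 else b i.2).

Definition block i w : R * R := (a i w, b i w).

Lemma measurable_block i : measurable_fun setT (block i).
Proof. by apply: measurable_fun_pair. Qed.

Lemma measurable_blockP i C : measurable C -> measurable (block i @^-1` C).
Proof. by move=> mC; rewrite -[X in measurable X]setTI; exact: measurable_block. Qed.

Lemma rectangles_independent (J : seq I) (A B : I -> set R) :
  uniq J -> (forall i, i \in J -> D i) ->
  (forall i, measurable (A i)) -> (forall i, measurable (B i)) ->
  P (\big[setI/setT]_(i <- J) (block i @^-1` (A i `*` B i))) =
  (\prod_(i <- J) (P (a i @^-1` A i) * P (b i @^-1` B i)))%E.
Proof.
move=> uJ JD mA mB.
pose J2 := [seq (true, i) | i <- J] ++ [seq (false, i) | i <- J].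
pose B2 (i : bool * I) := if i.1 then A i.2 else B i.2.
rewrite (eq_bigr (fun i => a i @^-1` A i `&` b i @^-1` B i))//.
rewrite !big_split/=.
have := @indep J2 B2 _ _ _; rewrite bigcap_seq /J2 !big_cat !big_map/= /B2/=; apply.
- rewrite cat_uniq !map_inj_uniq ?uJ//= => [|x y []//|x y []//].
  by rewrite andbT; apply/hasPn => _ /mapP[x _ ->]; apply/mapP => -[].
- by move=> i; rewrite mem_cat => /orP[] /mapP[x xJ ->] /=; exact: JD.
- by move=> -[[] i]/=.
Qed.

Lemma rectangle_block i A B : D i -> measurable A -> measurable B ->
  P (block i @^-1` (A `*` B)) = (P (a i @^-1` A) * P (b i @^-1` B))%E.
Proof.
move=> Di mA mB.
have := @rectangles_independent [:: i] (fun=> A) (fun=> B).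
rewrite !big_cons !big_nil setIT mule1; apply => // j.
by rewrite inE => /eqP ->.
Qed.

Lemma blocks_independent (J : seq I) (C : I -> set (R * R)) :
  uniq J -> (forall i, i \in J -> D i) -> (forall i, measurable (C i)) ->
  P (\big[setI/setT]_(i <- J) (block i @^-1` C i)) =
  (\prod_(i <- J) P (block i @^-1` C i))%E.
Proof.
move=> uJ JD mC.
(* The indices in [J] carry arbitrary measurable sets, those in [J'] rectangles, for which
   independence is known. Each induction step frees one index: as measures in [C i], both sides
   agree on rectangles, hence everywhere. *)
suff gen (J' : seq I) : forall (C : I -> set (R * R)), (forall i, measurable (C i)) ->
    (forall i, i \in J' -> rectangle (C i)) ->
    uniq (J ++ J') -> (forall i, i \in J ++ J' -> D i) ->
    P (\big[setI/setT]_(i <- J ++ J') (block i @^-1` C i)) =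
    (\prod_(i <- J ++ J') P (block i @^-1` C i))%E.
  by rewrite -[J]cats0; apply: gen => //; rewrite cats0.
elim: J J' {uJ JD C mC} => [|i J IH] J' C mC rC uJ JD; rewrite ?cat0s.
  have {}rC : forall i, exists AB : set R * set R,
      [/\ measurable AB.1, measurable AB.2 & i \in J' -> C i = AB.1 `*` AB.2].
    move=> i; case: (boolP (i \in J')) => [/rC[A [B [mA mB CAB]]]|_].
      by exists (A, B); split.
    exists (setT, setT); split => //=.
  have [AB HAB] := choice rC.
  have CE i : i \in J' -> C i = (AB i).1 `*` (AB i).2 by case: (HAB i).
  have mA i : measurable (AB i).1 by case: (HAB i).
  have mB i : measurable (AB i).2 by case: (HAB i).
  rewrite (eq_big_seq _ (fun i iJ => congr1 (preimage (block i)) (CE i iJ))).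
  rewrite rectangles_independent//.
  by apply: eq_big_seq => i iJ; rewrite CE// rectangle_block//; exact: JD.
rewrite cat_cons !big_cons.
pose E := \big[setI/setT]_(j <- J ++ J') (block j @^-1` C j).
have mE : measurable E by apply: bigsetI_measurable => j _; exact: measurable_blockP.
have Di : D i by apply: JD; rewrite inE eqxx.
have [/= iJ uJ'] : i \notin J ++ J' /\ uniq (J ++ J') by move: uJ => /= /andP.
have PE : P E = (\prod_(j <- J ++ J') P (block j @^-1` C j))%E.
  apply: IH => // j jJ; apply: JD; by rewrite inE jJ orbT.
rewrite -/E -PE.
have PEf : P E \is a fin_num by rewrite fin_num_measure.
move: (C i) (mC i) => Ci mCi.
pose mb := measurable_block i.
pose f1 : {measure set (R * R)%type -> \bar R} :=
  pushforward (mrestr P mE) (block i).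
pose f2 : {measure set (R * R)%type -> \bar R} :=
  mscale (NngNum (fine_ge0 (measure_ge0 P E))) (pushforward P (block i)).
pose n1 := f1 mb; pose n2 := f2 mb.
have n12 : n1 Ci = n2 Ci; last first.
  rewrite muleC; move: n12; rewrite /n1 /n2 /= /pushforward /mrestr /mscale/= /pushforward => ->.
  by rewrite fineK.
apply: (@eq_measure_rectangle _ _ _ _ _ n1 n2) => //.
  rewrite /n1 /= /pushforward /mrestr preimage_setT setTI.
  by rewrite ltey_eq PEf.
move=> _ [A [B [mA mB ->]]].
rewrite /n1 /n2 /= /pushforward /mrestr /mscale /= /pushforward fineK//.
(* With a rectangle at [i], this index may be counted among [J'], and the induction hypothesis
   applies. *)
pose C' j := if j == i then A `*` B else C j.
have := IH (i :: J') C'.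
rewrite muleC.
have perm : perm_eq (J ++ i :: J') (i :: J ++ J').
  by have := perm_catCA J [:: i] J'; move/permPl.
rewrite !(perm_big _ perm) !big_cons/= /C' eqxx.
have E1 : \big[setI/setT]_(j <- J ++ J') (block j @^-1` (if j == i then A `*` B else C j)) = E.
  apply: eq_big_seq => j jJ; case: eqP => // ji; by rewrite -ji jJ in iJ.
have E2 : (\prod_(j <- J ++ J') P (block j @^-1` (if j == i then A `*` B else C j)) = P E)%E.
  rewrite PE; apply: eq_big_seq => j jJ; case: eqP => // ji; by rewrite -ji jJ in iJ.
rewrite E1 E2; apply.
- move=> j; case: ifP => // _; exact: measurableX.
- move=> j; rewrite inE => /predU1P[->|jJ]; first by rewrite eqxx; exists A, B.
  by case: ifP => [_|_]; [exists A, B|exact: rC].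
- by rewrite (perm_uniq perm).
- by move=> j; rewrite (perm_mem perm); exact: JD.
Qed.

Lemma block_law i C : D i -> measurable C ->
  P (block i @^-1` C) = (distribution P (a i) \x distribution P (b i))%E C.
Proof.
move=> Di mC.
pose law : {measure set (R * R)%type -> \bar R} := pushforward P (block i).
rewrite (@product_measure_unique _ _ _ _ _ _ _ (law (measurable_block i)))//.
by move=> A B mA mB; exact: rectangle_block.
Qed.

End Blocks.

(** * Thresholds with uniform law *)

(** The distribution function of the uniform law on [0, 1], that is, of a threshold. *)
Definition clip {R : realType} (x : R) : R := Num.min (Num.max x 0) 1.

Lemma clipE {R : realType} (x : R) :
  clip x = if x < 0 then 0 else if x < 1 then x else 1.
Proof.
rewrite /clip; case: (ltP x 0) => x0; last by [].
by case: ltP => // ?; lra.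
Qed.

Lemma clip01 {R : realType} (x : R) : 0 <= clip x <= 1.
Proof. by rewrite clipE; case: (ltP x 0) => x0; [|case: (ltP x 1) => ?]; lra. Qed.

Lemma clip_id {R : realType} (x : R) : 0 <= x <= 1 -> clip x = x.
Proof.
by rewrite clipE => /andP[? ?]; case: (ltP x 0) => x0; [|case: (ltP x 1) => ?]; lra.
Qed.

Lemma clip_le {R : realType} (x y : R) : x <= y -> clip x <= clip y.
Proof.
rewrite !clipE => xy; case: (ltP x 0) => ?; case: (ltP x 1) => ?;
  case: (ltP y 0) => ?; case: (ltP y 1) => ?; lra.
Qed.

Lemma clip_lip {R : realType} (x y : R) : x <= y -> clip y <= clip x + (y - x).
Proof.
rewrite !clipE => xy; case: (ltP x 0) => ?; case: (ltP x 1) => ?;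
  case: (ltP y 0) => ?; case: (ltP y 1) => ?; lra.
Qed.

Lemma measurable_clip {R : realType} : measurable_fun setT (@clip R).
Proof.
by apply: measurable_minr => //; apply: measurable_maxr.
Qed.

Lemma uniform_prob_le {R : realType} (c : R) :
  uniform_prob (@ltr01 R) [set x | x <= c] = (clip c)%:E.
Proof.
rewrite /uniform_prob integral_uniform_pdf.
have [c0|c0] := ltP c 0.
  rewrite (_ : _ `&` _ = set0) ?integral_set0.
    by rewrite clipE c0.
  rewrite -subset0 => x [/= xc]; rewrite in_itv/= => /andP[x0 _]; lra.
rewrite (_ : _ `&` _ = `[0, clip c]%classic).
  rewrite (eq_integral (cst 1%E)) => [|x]; last first.
    rewrite inE/= in_itv/= => /andP[x0 xc]; rewrite /uniform_pdf subr0 invr1.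
    by case/andP: (clip01 c) => _ c1; rewrite x0 (le_trans xc c1).
  rewrite integral_cst// mul1e. rewrite [LHS]lebesgue_measure_itv/= lte_fin.
  case: ltP => [_|cc]; first by rewrite oppr0 addr0.
  by apply/eqP; rewrite eqe eq_le cc; case/andP: (clip01 c) => ->.
apply/seteqP; split=> x /=; rewrite !in_itv/= clipE;
  by case: (ltP c 0) => ?; case: (ltP c 1) => ?; lra.
Qed.

Section Hit.
Context {R : realType} {d} {Omega : measurableType d} {P : probability Omega R}.
Context (a b : {RV P >-> R}).

Definition hit (y : R) := [set w | b w <= y + a w].

Definition hitC (y : R) : set (R * R) := [set q | q.2 <= y + q.1].

Lemma measurable_hitC y : measurable (hitC y).
Proof.
rewrite -[X in measurable X]setTI.
apply: (@measurable_fun_le _ _ _ setT (fun q : R * R => q.2)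
  (fun q => y + q.1)) => //.
- exact: measurable_snd.
- exact: (measurable_funD (measurable_cst _) measurable_fst).
Qed.

Hypothesis law : forall C : set (R * R), measurable C ->
  P ((fun w => (a w, b w)) @^-1` C) = (distribution P a \x distribution P b)%E C.
Hypothesis bU : forall B : set R, measurable B ->
  distribution P b B = uniform_prob (@ltr01 R) B.

(** The threshold is integrated out first, for a fixed value of the noise. *)
Lemma hit_prob y : P (hit y) = (\int[P]_w (clip (y + a w))%:E)%E.
Proof.
have -> : hit y = (fun w => (a w, b w)) @^-1` hitC y by [].
rewrite law; last exact: measurable_hitC.
rewrite /product_measure1.
rewrite (eq_integral (fun e => (clip (y + e))%:E)); last first.
  move=> e _ /=.
  have -> : xsection (hitC y) e = [set x | x <= y + e].
    by apply/seteqP; split=> x; rewrite /xsection /hitC/= inE.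
  rewrite bU ?uniform_prob_le//.
  by rewrite -set_itvNyc; exact: measurable_itv.
rewrite ge0_integral_distribution//.
- apply/measurable_EFinP; apply: measurableT_comp; first exact: measurable_clip.
  exact: measurable_funD.
- by move=> e; rewrite lee_fin; case/andP: (clip01 (y + e)).
Qed.

Lemma measurable_clipD y : measurable_fun setT (fun w => clip (y + a w)).
Proof.
by apply: measurableT_comp; [exact: measurable_clip|exact: measurable_funD].
Qed.

Lemma integrable_clipD y : P.-integrable setT (EFin \o (fun w => clip (y + a w))).
Proof.
apply: (@le_integrable _ _ _ P setT _ _ (EFin \o cst 1)) => //.
- apply/measurable_EFinP; exact: measurable_clipD.
- by move=> w _ /=; rewrite normr1 lee_fin ger0_norm; case/andP: (clip01 (y + a w)).
- by apply: finite_measure_integrable_cst.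
Qed.

Definition hitF y : R := fine (P (hit y)).

Lemma hitFE y : (hitF y)%:E = (\int[P]_w (clip (y + a w))%:E)%E.
Proof.
rewrite -hit_prob /hitF fineK// fin_num_measure//.
have -> : hit y = (fun w => (a w, b w)) @^-1` hitC y by [].
rewrite -[X in measurable X]setTI; apply: measurable_fun_pair => //.
exact: measurable_hitC.
Qed.

Lemma hitF01 y : 0 <= hitF y <= 1.
Proof.
rewrite -!lee_fin hitFE integral_ge0//=; last first.
  by move=> w _; rewrite lee_fin; case/andP: (clip01 (y + a w)).
rewrite -hit_prob probability_le1//.
have -> : hit y = (fun w => (a w, b w)) @^-1` hitC y by [].
rewrite -[X in measurable X]setTI; apply: measurable_fun_pair => //.
exact: measurable_hitC.
Qed.

Lemma hitF_le x y : x <= y -> hitF x <= hitF y.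
Proof.
move=> xy; rewrite -lee_fin !hitFE; apply: ge0_le_integral => //.
- by move=> w _; rewrite lee_fin; case/andP: (clip01 (x + a w)).
- apply/measurable_EFinP; exact: measurable_clipD.
- apply/measurable_EFinP; exact: measurable_clipD.
- by move=> w _; rewrite lee_fin clip_le// lerD2r.
Qed.

Lemma hitF_lip x y : x <= y -> hitF y <= hitF x + (y - x).
Proof.
move=> xy; rewrite -lee_fin EFinD !hitFE.
have -> : (y - x)%:E = (\int[P]_w (y - x)%:E)%E.
  by rewrite integral_cst// [X in (_ * X)%E]probability_setT mule1.
have yx : 0 <= y - x by rewrite subr_ge0.
rewrite -ge0_integralD//=.
- apply: ge0_le_integral => //.
  + by move=> w _; rewrite lee_fin; case/andP: (clip01 (y + a w)).
  + apply/measurable_EFinP; exact: measurable_clipD.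
  + apply/measurable_EFinP; apply: measurable_funD => //; exact: measurable_clipD.
  + move=> w _; rewrite lee_fin.
    have := @clip_lip _ (x + a w) (y + a w); rewrite lerD2r => /(_ xy); lra.
- by move=> w _; rewrite lee_fin; case/andP: (clip01 (x + a w)).
- apply/measurable_EFinP; exact: measurable_clipD.
Qed.

(** Clipping has no effect here, and the centred noise averages out. *)
Lemma hitF_id y : ('E_P[a] = 0)%E -> {ae P, forall w, 0 <= y + a w <= 1} ->
  hitF y = y.
Proof.
move=> Ea ya; apply/EFin_inj; rewrite hitFE.
(* Almost surely the noise equals a bounded function, whose integral can be split. *)
have : (\int[P]_w (a w)%:E = \int[P]_w ((clip (y + a w))%:E - y%:E))%E.
  apply: ae_eq_integral => //.
  - exact/measurable_EFinP.
  - apply/measurable_EFinP; apply: measurable_funB => //; exact: measurable_clipD.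
  - apply: filterS ya => w H _; rewrite clip_id// -EFinB; congr EFin; lra.
rewrite expectation_def in Ea; rewrite Ea integralB//; last 2 first.
- exact: integrable_clipD.
- exact: finite_measure_integrable_cst.
rewrite integral_cst// [X in (_ * X)%E]probability_setT mule1 -hitFE -EFinB => -[]H.
by congr EFin; lra.
Qed.

End Hit.

(** * Finitely valued random elements *)

Section FiniteValued.
Context {R : realType} {d} {Omega : measurableType d} (P : probability Omega R).

Lemma fin_expectation (F : finType) (Z : Omega -> F) (g : F -> R) :
  (forall z, measurable (Z @^-1` [set z])) ->
  ('E_P[fun w => g (Z w)] = (\sum_z fine (P (Z @^-1` [set z])) * g z)%:E)%E.
Proof.
move=> mZ; rewrite unlock.
have PZ z : P (Z @^-1` [set z]) \is a fin_num by rewrite fin_num_measure.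
rewrite (eq_integral (fun w => \sum_z (g z)%:E * (\1_(Z @^-1` [set z]) w)%:E)%E); last first.
  move=> w _; rewrite (bigD1 (Z w))//= big1 => [|z zw].
    by rewrite indicE mem_set// mule1 adde0.
  by rewrite indicE memNset ?mule0// => /= Zw; rewrite Zw eqxx in zw.
have integ z : P.-integrable setT (fun w => (\1_(Z @^-1` [set z]) w)%:E).
  exact: integrable_indic.
rewrite integral_sum//; last by move=> z; exact: integrableZl.
rewrite -sumEFin; apply: eq_bigr => z _.
by rewrite integralZl// integral_indic// setIT EFinM fineK// muleC.
Qed.

Section ProductLaw.
Context {K : choiceType} (D : set K) (a b : K -> {RV P >-> R}).
Hypothesis indep : mutually_independent [set i : bool * K | D i.2]
  (fun i => if i.1 then a i.2 else b i.2).
Context {I F : finType} (DI : pred I) (k : I -> K).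
Hypothesis k_inj : injective k.
Hypothesis k_D : forall i, DI i -> D (k i).
Context (phi : I -> R * R -> F) (c : I -> F).
Hypothesis mphi : forall i z, measurable (phi i @^-1` [set z]).

(** Coordinates outside [DI] are frozen at [c]; this makes room for the node [hid0], which is
    outside the independent family. *)
Definition elements (w : Omega) : {ffun I -> F} :=
  [ffun i => if DI i then phi i (block a b (k i) w) else c i].

Definition element_law (i : I) (z : F) : R :=
  if DI i then fine (P (block a b (k i) @^-1` (phi i @^-1` [set z])))
  else (z == c i)%:R.

Let mblock i C : measurable C -> measurable (block a b i @^-1` C).
Proof. by move=> mC; apply: measurable_blockP. Qed.

Lemma elements_preimage z : elements @^-1` [set z] =
  if [forall i, ~~ DI i ==> (z i == c i)] then
    \big[setI/setT]_(i <- enum DI) (block a b (k i) @^-1` (phi i @^-1` [set z i]))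
  else set0.
Proof.
case: ifPn => [/forallP H|/forallPn[i]]; last first.
  rewrite negb_imply => /andP[Di /eqP zi].
  rewrite -subset0 => w /= wz; apply: zi; rewrite -wz ffunE.
  by rewrite (negbTE Di).
rewrite -bigcap_seq; apply/seteqP; split=> w /=.
  move=> wz i /=; rewrite mem_enum => Di.
  by rewrite /preimage/= -wz ffunE; move: Di; rewrite unfold_in => ->.
move=> wz; apply/ffunP => i; rewrite ffunE; case: ifPn => Di.
  by have := wz i; rewrite /= mem_enum; apply.
by have := H i; rewrite Di => /eqP.
Qed.

Lemma measurable_elements z : measurable (elements @^-1` [set z]).
Proof.
rewrite elements_preimage; case: ifPn => _; last exact: measurable0.
by apply: bigsetI_measurable => i _; exact: mblock.
Qed.

Lemma elements_law z :
  P (elements @^-1` [set z]) = (\prod_i element_law i (z i))%:E.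
Proof.
rewrite elements_preimage; case: ifPn => [/forallP H|/forallPn[i]]; last first.
  rewrite negb_imply => /andP[Di /negbTE zi].
  by rewrite measure0 (bigD1 i)//= /element_law (negbTE Di) zi mul0r.
pose C (kap : K) : set (R * R) :=
  if [pick i | DI i && (k i == kap)] is Some i then phi i @^-1` [set z i] else setT.
have CE i : DI i -> C (k i) = phi i @^-1` [set z i].
  move=> Di; rewrite /C; case: pickP => [j /andP[_ /eqP/k_inj ->]//|].
  by move=> /(_ i); rewrite Di eqxx.
have mC kap : measurable (C kap).
  by rewrite /C; case: pickP => [i _|_]; [exact: mphi|exact: measurableT].
have := @blocks_independent _ _ _ _ _ D a b indep [seq k i | i <- enum DI] C.
rewrite !big_map.
rewrite (eq_big_seq (fun i => block a b (k i) @^-1` (phi i @^-1` [set z i]))); last first.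
  by move=> i; rewrite mem_enum => Di; rewrite CE.
move=> ->//; last 2 first.
- by rewrite map_inj_uniq// enum_uniq.
- by move=> kap /mapP[i]; rewrite mem_enum => Di ->; exact: k_D.
rewrite big_enum/= [in RHS](bigID DI)/= [X in (_ * X)%:E]big1 ?mulr1; last first.
  move=> i Di; rewrite /element_law (negbTE Di).
  by have := H i; rewrite Di/= => ->.
rewrite -prodEFin; apply: eq_big => // i Di.
rewrite /element_law; move: Di; rewrite unfold_in => Di; rewrite Di CE// fineK//.
by rewrite fin_num_measure//; apply: mblock; exact: mphi.
Qed.

Lemma element_law_pmf i : is_pmf (element_law i).
Proof.
rewrite /is_pmf /element_law; case: (boolP (DI i)) => Di; last first.
  split=> [z|]; first by rewrite ler0n.
  rewrite (bigD1 (c i))//= eqxx big1 ?addr0// => z /negbTE.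
  by move=> ->.
split=> [z|]; first by apply: fine_ge0; exact: measure_ge0.
pose Zi w := phi i (block a b (k i) w).
have mZi z : measurable (Zi @^-1` [set z]) by exact: (mblock _ (mphi i z)).
have := fin_expectation (fun=> 1) mZi.
have -> : (fun w => 1) = cst 1 :> (Omega -> R) by [].
rewrite expectation_cst => -[->]; by apply: eq_bigr => z _; rewrite mulr1.
Qed.

Lemma expectation_elements (g : {ffun I -> F} -> R) :
  ('E_P[fun w => g (elements w)] = (prodE element_law g)%:E)%E.
Proof.
rewrite fin_expectation; last exact: measurable_elements.
by congr EFin; apply: eq_bigr => z _; rewrite elements_law.
Qed.

End ProductLaw.
End FiniteValued.

(** * Random responses given by a noise and a threshold *)

Section ThresholdResponse.
Context {R : realType} {S : finType}.

Definition thr_resp (L : S -> R) (q : R * R) : {ffun S -> bool} :=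
  [ffun s => q.2 <= L s + q.1].

Lemma measurable_thr_resp (L : S -> R) z : measurable (thr_resp L @^-1` [set z]).
Proof.
rewrite (_ : _ @^-1` _ =
    \big[setI/setT]_(s <- enum S) (if z s then hitC (L s) else ~` hitC (L s))).
  apply: bigsetI_measurable => s _; case: (z s); [|apply: measurableC];
    exact: measurable_hitC.
rewrite -bigcap_seq; apply/seteqP; split=> q /=.
  move=> <- s _ /=; rewrite ffunE; case: ifPn => // /negP.
  by [].
move=> H; apply/ffunP => s; rewrite ffunE; have := H s.
rewrite /= mem_enum => /(_ isT); case: (z s) => //= /negP.
by move=> /negbTE.
Qed.

Context {d} {Omega : measurableType d} (P : probability Omega R).

Lemma thr_resp_mean {K : choiceType} (a b : K -> {RV P >-> R})
    {I : finType} (DI : pred I) (k : I -> K) (L : I -> S -> R)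
    (c : I -> {ffun S -> bool}) i s :
  DI i ->
  \sum_z element_law a b DI k (fun i => thr_resp (L i)) c i z * (z s)%:R =
  hitF (a (k i)) (b (k i)) (L i s).
Proof.
move=> Di.
pose Z w := thr_resp (L i) (block a b (k i) w).
have mZ z : measurable (Z @^-1` [set z]).
  apply: (@measurable_blockP _ _ _ P _ a b (k i) (thr_resp (L i) @^-1` [set z])).
  exact: measurable_thr_resp.
have := fin_expectation P (fun z : {ffun S -> bool} => (z s)%:R : R) mZ.
have -> : (fun w => (Z w s)%:R) = \1_(hit (a (k i)) (b (k i)) (L i s)) :> (Omega -> R).
  apply/funext => w; rewrite indicE /hit /Z ffunE /block/=; congr (nat_of_bool _)%:R.
  by apply/idP/idP => [?|]; [rewrite inE|rewrite inE].
rewrite expectation_indic; last first.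
  apply: (@measurable_blockP _ _ _ P _ a b (k i) (hitC (L i s))).
  exact: measurable_hitC.
rewrite /hitF => ->/=; apply: eq_bigr => z _.
by rewrite /element_law Di.
Qed.

End ThresholdResponse.

(** * The model [G] as a structural model with independent responses *)

Section Model.
Context {R : realType} {d} {Omega : measurableType d} {P : probability Omega R}.
Context {U X : finType} (m : blm P U X).
Hypothesis vm : valid_blm m.

Local Notation gnode := (node U X).
Local Notation u0 := (@hidden_node U X (hid0 m)).
Local Notation e := (edge m).
Local Notation noises := (fun i : nat * gnode => noise m i.1 i.2).
Local Notation threshs := (fun i : nat * gnode => thresh m i.1 i.2).
Local Notation Dn := [set i : nat * gnode | i.2 != u0].

(** The constant node [hid0] is encoded as a node that is permanently forced to 1. *)
Definition forced (iv : intervention X) (v : gnode) : option bool :=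
  match v with
  | inl u => if u == hid0 m then Some true else None
  | inr x => iv x
  end.

Lemma noise_indep : mutually_independent [set i : bool * (nat * gnode) | Dn i.2]
  (fun i => if i.1 then noises i.2 else threshs i.2).
Proof. exact: (blm_independent vm). Qed.

Definition node_resp (v : gnode) : R * R -> response (V := gnode) :=
  thr_resp (fun s : {ffun gnode -> bool} => linear_part m v s).

Definition resp0 : gnode -> response (V := gnode) := fun=> [ffun=> true].

Definition round_resp (t : nat) : Omega -> {ffun gnode -> response (V := gnode)} :=
  elements noises threshs (fun v => v != u0) (fun v => (t, v)) node_resp resp0.

Definition node_law_at (t : nat) : gnode -> response (V := gnode) -> R :=
  element_law noises threshs (fun v => v != u0) (fun v => (t, v)) node_resp resp0.

Definition node_law := node_law_at 0.

Lemma node_law_pmf v : is_pmf (node_law v).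
Proof. by apply: element_law_pmf => i z; exact: measurable_thr_resp. Qed.

(** The noise and the threshold of a node are independent, so their joint law is determined by the
    two marginals, which do not depend on the round. *)
Lemma node_law_atE t : node_law_at t = node_law.
Proof.
apply/funext => v; apply/funext => z; rewrite /node_law /node_law_at /element_law.
case: ifPn => // vu0; congr fine.
have mf s := @measurable_block _ _ _ P (nat * gnode)%type noises threshs (s, v).
pose f0 : {measure set (R * R)%type -> \bar R} := pushforward P (block noises threshs (0%N, v)).
pose ft : {measure set (R * R)%type -> \bar R} := pushforward P (block noises threshs (t, v)).
apply: (eq_measure_rectangle (m1 := ft (mf t)) (m2 := f0 (mf 0%N))).
- by rewrite /= /pushforward preimage_setT probability_setT ltry.
- move=> _ [A [B [mA mB ->]]]; rewrite /= /pushforward !(rectangle_block noise_indep)//=.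
  congr (_ * _)%E; first exact: (blm_noise_law vm).
  have := blm_thresh_law vm t vu0 mB; rewrite -(blm_thresh_law vm 0%N vu0 mB).
  by [].
- exact: measurable_thr_resp.
Qed.

Lemma linear_part_parmask v (s : gnode -> bool) :
  linear_part m v (parmask e v s) = linear_part m v s.
Proof. by apply: eq_bigr => w wv; rewrite ffunE wv. Qed.

Lemma eq_linear_part v (s s' : gnode -> bool) : s =1 s' -> linear_part m v s = linear_part m v s'.
Proof. by move=> ss; apply: eq_bigr => w wv; rewrite ss. Qed.

Lemma blm_valueE iv t w :
  blm_value m iv t w =1 scm_val e (forced iv) (round_resp t w).
Proof.
rewrite /blm_value /scm_val; elim: #|gnode| => // n IH v /=.
rewrite /structural_step /scm_step /=.
have resp v' s s' : v' != u0 -> s =1 s' ->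
    (round_resp t w) v' (parmask e v' s') =
    (thresh m t v' w <= linear_part m v' s + noise m t v' w).
  move=> v'0 ss; rewrite !ffunE v'0 /node_resp /= ffunE /= linear_part_parmask.
  by rewrite (eq_linear_part _ ss).
case: v => [u|x] /=.
  case: eqP => [//|/eqP uu0]; rewrite (resp _ (iter n (structural_step m iv t w) xpredT))//.
by case: (iv x) => //; rewrite (resp _ (iter n (structural_step m iv t w) xpredT)).
Qed.

Lemma expectation_round t (g : {ffun gnode -> response (V := gnode)} -> R) :
  ('E_P[fun w => g (round_resp t w)] = (prodE node_law g)%:E)%E.
Proof.
rewrite -(node_law_atE t).
apply: (expectation_elements noise_indep) => //.
- by move=> v v' [].
- by move=> i z; exact: measurable_thr_resp.
Qed.

Lemma node_hitF_id v (s : gnode -> bool) : v != u0 -> s u0 ->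
  hitF (noise m 0 v) (thresh m 0 v) (linear_part m v s) = linear_part m v s.
Proof.
move=> vu0 su0; apply: hitF_id.
- move=> C mC; exact: (@block_law _ _ _ P _ Dn noises threshs noise_indep (0%N, v)).
- exact: (blm_thresh_law vm).
- exact: (blm_noise_mean vm).
- by apply: filterS (blm_prob01 vm 0%N vu0) => w /(_ s su0).
Qed.

Lemma node_resp_mean v (s : gnode -> bool) : v != u0 -> s u0 ->
  resp_mean (node_law v) (parmask e v s) = linear_part m v s.
Proof.
move=> vu0 su0; rewrite /resp_mean /node_law /node_law_at.
have := @thr_resp_mean R _ _ _ P _ noises threshs _ (fun v => v != u0) (fun v => (0%N, v))
  (fun v (s : {ffun gnode -> bool}) => linear_part m v s) resp0 v (parmask e v s) vu0.
move=> ->/=; by rewrite linear_part_parmask node_hitF_id.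
Qed.

Lemma linear_part01 v (s : gnode -> bool) : v != u0 -> s u0 -> 0 <= linear_part m v s <= 1.
Proof.
move=> vu0 su0; rewrite -node_hitF_id//; apply: hitF01.
- move=> C mC; exact: (@block_law _ _ _ P _ Dn noises threshs noise_indep (0%N, v)).
- exact: (blm_thresh_law vm).
Qed.

Definition gval (iv : intervention X) := @scm_val gnode e (forced iv).

Definition roundE (g : {ffun gnode -> response (V := gnode)} -> R) := prodE node_law g.

Lemma gval_u0 iv z : gval iv z u0.
Proof. by apply: (scm_val_forced (blm_acyclic vm)); rewrite /= eqxx. Qed.

(** The weight [g] stands for a conditioning: under it means stay linear along edges as long as it
    ignores the response of [v]. *)
Lemma gval_mean iv v (g : {ffun gnode -> response (V := gnode)} -> R) :
  v != u0 -> forced iv v = None -> (forall z b, g (upd z v b) = g z) ->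
  roundE (fun z => (gval iv z v)%:R * g z) =
  \sum_(w | e w v) weight m w v * roundE (fun z => (gval iv z w)%:R * g z).
Proof.
move=> vu0 ivv gu; rewrite /roundE /gval (scm_mean (blm_acyclic vm) node_law_pmf ivv gu).
under [RHS]eq_bigr do rewrite -prodEZ.
rewrite -prodE_sum; apply: eq_prodE => z.
rewrite node_resp_mean//; last exact: gval_u0.
by rewrite /linear_part big_distrl; apply: eq_bigr => w _; rewrite /= mulrA.
Qed.

Lemma expected_YE S : expected_Y m S = roundE (fun z => (gval (do_ones S) z (inr None))%:R).
Proof.
pose f (z : {ffun gnode -> response (V := gnode)}) : R :=
  (gval (do_ones S) z (inr None))%:R.
have -> : expected_Y m S = fine ('E_P[fun w => f (round_resp 0 w)])%E.
  congr (fine 'E_P[_]); apply/funext => w.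
  by rewrite /f /gval -blm_valueE.
by rewrite expectation_round.
Qed.

Lemma tweight_NoneE x :
  tweight m None x = roundE (fun z => (gval (do_zeros_but x) z (inr x))%:R).
Proof.
rewrite /tweight.
pose f (z : {ffun gnode -> response (V := gnode)}) : R := (gval (do_zeros_but x) z (inr x))%:R.
have := expectation_round 0 f.
have -> : (fun w => f (round_resp 0 w)) = \1_[set w | obs_value m (do_zeros_but x) 0 w x].
  apply/funext => w; rewrite indicE /f /gval -blm_valueE; congr (nat_of_bool _)%:R.
  by apply/idP/idP => [?|]; [rewrite inE|rewrite inE].
rewrite expectation_indic; first by move=> ->.
rewrite (_ : [set _ | _] = \bigcup_(z in [set z | gval (do_zeros_but x) z (inr x)])
    (round_resp 0 @^-1` [set z])).
  apply: fin_bigcup_measurable; first exact: finite_finset.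
  move=> z _; apply: measurable_elements.
  by move=> i z'; exact: measurable_thr_resp.
apply/seteqP; split=> w /=; rewrite /obs_value blm_valueE => H.
  by exists (round_resp 0 w).
by case: H => z /= H1 H2; rewrite H2.
Qed.

End Model.

(** * Elimination of the hidden nodes *)

Section HiddenPaths.
Context {R : realType} {d} {Omega : measurableType d} {P : probability Omega R}.
Context {U X : finType} (m : blm P U X).
Hypothesis vm : valid_blm m.

Local Notation gnode := (node U X).
Local Notation u0 := (@hidden_node U X (hid0 m)).
Local Notation e := (edge m).

Definition hidden_weight (k : nat) (a : gnode) (x : obs X) : R :=
  \sum_(p : k.-tuple U | is_hidden_path m a p x)
    path_weight m a (rcons (map (@hidden_node U X) p) (obs_node U x)).

Lemma hidden_paths_weightE a x :
  hidden_paths_weight m a x = \sum_(k < #|U|.+1) hidden_weight k a x.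
Proof. by []. Qed.

Lemma hidden_weight0 a x :
  hidden_weight 0 a x = if e a (inr x) then weight m a (inr x) else 0.
Proof.
rewrite /hidden_weight; case: ifP => ax; last first.
  by rewrite big_pred0// => p; rewrite tuple0 /is_hidden_path/= ax.
rewrite (big_pred1 [tuple]) /= ?mulr1// => p.
by rewrite [p]tuple0 /is_hidden_path/= ax eqxx.
Qed.

Lemma hidden_weightS k a x : hidden_weight k.+1 a x =
  \sum_(u | e a (inl u)) weight m a (inl u) * hidden_weight k (inl u) x.
Proof.
under eq_bigr do rewrite /hidden_weight big_distrr/=.
rewrite pair_big_dep/=.
pose f (q : U * k.-tuple U) : k.+1.-tuple U := [tuple of q.1 :: q.2].
pose g (p : k.+1.-tuple U) : U * k.-tuple U := (thead p, [tuple of behead p]).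
rewrite /hidden_weight (reindex f) /=; last first.
  exists g => [[u p] _|p _]; rewrite /f /g/=.
    by congr pair; apply: val_inj.
  by case/tupleP: p => u p; apply: val_inj.
by apply: eq_big => [[u p]|[u p] _] //=.
Qed.

Lemma hidden_weight_neq0 k a x : hidden_weight k a x != 0 ->
  exists p : k.-tuple U, is_hidden_path m a p x.
Proof.
move=> H; apply/existsP; apply: contraNT H; rewrite negb_exists => /forallP H.
by rewrite /hidden_weight big1// => p; rewrite (negbTE (H p)).
Qed.

Lemma hidden_path_has k a x (p : k.-tuple U) : (k <= #|U|)%N ->
  is_hidden_path m a p x -> has_hidden_path m a x.
Proof.
move=> kU ap; apply/existsP; exists (Ordinal (kU : k < #|U|.+1)%N) => /=.
by apply/existsP; exists p.
Qed.

Lemma path_uniq a s : path e a s -> uniq (a :: s).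
Proof.
move=> es; have acyc := blm_acyclic vm.
pose r (v w : gnode) := (rank e v < rank e w)%N.
have rt : transitive r by move=> y x z; exact: ltn_trans.
apply: (@sorted_uniq _ r rt) => [v|]; first by rewrite /r ltnn.
rewrite /=; apply: sub_path es => v w; exact: edge_rank.
Qed.

(** A path is simple, so such a path would visit [k.+1] distinct hidden nodes, more than there
    are. *)
Lemma hidden_weight_big u x k : (#|U| <= k)%N -> hidden_weight k (inl u) x = 0.
Proof.
move=> kU; apply/eqP; apply/negP => /negP /hidden_weight_neq0[p].
rewrite /is_hidden_path => /path_uniq; rewrite -rcons_cons rcons_uniq => /andP[_].
rewrite -[_ :: _]/(map (@hidden_node U X) (u :: p)) map_inj_uniq; last by move=> ? ? [].
by move=> /card_uniqP cu; have := max_card (mem (u :: p)); rewrite cu/= size_tuple ltnNge kU.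
Qed.

(** The relation is substituted repeatedly for the hidden nodes other than [hid0]. After [n]
    substitutions the remainder is carried by hidden paths with [n] intermediate nodes, and it
    vanishes at [n = #|U|]. Only nodes with a hidden path to [x] are ever substituted. *)
Lemma hidden_unroll (a : gnode -> R) x :
  (forall v, v = inr x \/ (exists u, [/\ v = inl u, u != hid0 m & has_hidden_path m v x]) ->
    a v = \sum_(w | e w v) weight m w v * a w) ->
  a (inr x) = \sum_y hidden_paths_weight m (inr y) x * a (inr y) +
              hidden_paths_weight m u0 x * a u0.
Proof.
move=> aE.
have split (f : gnode -> R) : \sum_w f w =
    \sum_y f (inr y) + f u0 + \sum_(u | u != hid0 m) f (inl u).
  by rewrite big_sumType/= (bigD1 (hid0 m))//= [LHS]addrC addrA.
have main n : (n <= #|U|)%N -> a (inr x) =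
    \sum_(k < n.+1) (\sum_y hidden_weight k (inr y) x * a (inr y) + hidden_weight k u0 x * a u0)
    + \sum_(u | u != hid0 m) hidden_weight n (inl u) x * a (inl u).
  elim: n => [|n IH] nU.
    rewrite big_ord1/= -(split (fun w => hidden_weight 0 w x * a w)) aE; last by left.
    rewrite big_mkcond; apply: eq_bigr => w _; rewrite hidden_weight0.
    by case: ifP; rewrite ?mul0r.
  rewrite IH ?(ltnW nU)// [in RHS]big_ord_recr/= -addrA; congr (_ + _).
  rewrite -(split (fun w => hidden_weight n.+1 w x * a w)).
  transitivity (\sum_(u | u != hid0 m) \sum_(w | e w (inl u))
      hidden_weight n (inl u) x * (weight m w (inl u) * a w)).
    apply: eq_bigr => u uu0; rewrite -big_distrr/=.
    have [->|/hidden_weight_neq0[p pu]] := eqVneq (hidden_weight n (inl u) x) 0.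
      by rewrite !mul0r.
    rewrite aE//; right; exists u; split => //.
    by apply: hidden_path_has pu; exact: ltnW.
  rewrite (exchange_big_dep xpredT)//=; apply: eq_bigr => w _.
  rewrite hidden_weightS big_distrl/=; apply: eq_big => [u|u _]; last by ring.
  case: eqP => [->|_]//=; by rewrite (negbTE (blm_hid0_source vm w)).
rewrite (main #|U|)// [X in _ + X]big1 ?addr0; last first.
  by move=> u _; rewrite hidden_weight_big// mul0r.
rewrite big_split/= exchange_big/=; congr (_ + _).
  by apply: eq_bigr => y _; rewrite hidden_paths_weightE big_distrl.
by rewrite hidden_paths_weightE big_distrl.
Qed.

Lemma has_hidden_connect a x : has_hidden_path m a x -> connect e a (inr x).
Proof.
case/existsP => k /existsP[p]; rewrite /is_hidden_path => ep.
by apply/connectP; eexists; [exact: ep|rewrite last_rcons].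
Qed.

Lemma has_hidden_neq (y x : obs X) : has_hidden_path m (inr y) x -> y != x.
Proof.
case/existsP => k /existsP[p] /path_uniq /=; rewrite mem_rcons inE.
by case/andP; rewrite negb_or => /andP[+ _] _; apply: contra => /eqP ->.
Qed.

Lemma hidden_paths_weight_eq0 a x : ~~ has_hidden_path m a x -> hidden_paths_weight m a x = 0.
Proof.
move=> nh; rewrite hidden_paths_weightE big1// => k _; apply/eqP.
apply: contraNT nh => /hidden_weight_neq0[p]; apply: hidden_path_has.
by rewrite -ltnS.
Qed.

Lemma has_hidden_cons a u x : e a (inl u) -> has_hidden_path m (inl u) x ->
  has_hidden_path m a x.
Proof.
move=> au /existsP[k /existsP[p pu]].
have : is_hidden_path m a (u :: p) x by rewrite /is_hidden_path/= au.
have kU : (k.+1 <= #|U|)%N.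
  rewrite ltnNge; apply/negP => kU.
  move: pu; rewrite /is_hidden_path => /path_uniq; rewrite -rcons_cons rcons_uniq => /andP[_].
  rewrite -[_ :: _]/(map (@hidden_node U X) (u :: p)) map_inj_uniq; last by move=> ? ? [].
  by move=> /card_uniqP cu; have := max_card (mem (u :: p)); rewrite cu/= size_tuple ltnNge kU.
move=> H; exact: (@hidden_path_has k.+1 a x [tuple of u :: p]).
Qed.

Lemma has_hidden_edge a x : e a (inr x) -> has_hidden_path m a x.
Proof.
move=> ax; apply: (@hidden_path_has 0 a x [tuple]) => //.
by rewrite /is_hidden_path/= ax.
Qed.

End HiddenPaths.

(** * The transformed model *)

Section Transformed.
Context {R : realType} {d} {Omega : measurableType d} {P : probability Omega R}.
Context {U X : finType} (m : blm P U X).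
Hypothesis vm : valid_blm m.

Local Notation gnode := (node U X).
Local Notation u0 := (@hidden_node U X (hid0 m)).
Local Notation e := (edge m).
Local Notation gE := (roundE m).
Local Notation gval := (gval m).

Definition tedge : rel (obs X) := fun y x => has_hidden_path m (inr y) x.

Lemma connect_antisym v w : connect e v w -> connect e w v -> v = w.
Proof.
case/connectP => -[_ ->//|b p /= /andP[vb bp] wE] wv.
have := blm_acyclic vm vb; rewrite (connect_trans _ wv)//.
by apply/connectP; exists p.
Qed.

Lemma tedge_connect y x : connect tedge y x -> connect e (inr y) (inr x).
Proof.
case/connectP => p; elim: p y => [y _ ->//|z p IH] y /= /andP[yz zp] xE.
exact: connect_trans (has_hidden_connect yz) (IH _ zp xE).
Qed.

Lemma tedge_acyclic y x : tedge y x -> ~~ connect tedge x y.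
Proof.
move=> yx; apply/negP => /tedge_connect xy.
have := has_hidden_neq vm yx; have := connect_antisym (has_hidden_connect yx) xy.
by case=> ->; rewrite eqxx.
Qed.

Lemma first_observed u y : connect e (inl u) (inr y) ->
  exists y', has_hidden_path m (inl u) y' /\ connect e (inr y') (inr y).
Proof.
case/connectP => p; elim: p u => [u _ //|b p IH] u /= /andP[ub bp] yE.
case: b ub bp yE => [u'|y'] ub bp yE.
  have [y' [h1 h2]] := IH u' bp yE; exists y'; split => //.
  exact: has_hidden_cons ub h1.
exists y'; split; first exact: has_hidden_edge.
by apply/connectP; exists p.
Qed.

(* Admissibility enters only here: the hidden causes of [x] that act without
   passing through an observed node have no influence on the parents of [x]. *)
Lemma hidden_cause_parent v x y :
  v = inr x \/ (exists u, [/\ v = inl u, u != hid0 m & has_hidden_path m v x]) ->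
  tedge y x -> ~~ connect e v (inr y).
Proof.
move=> vx yx; apply/negP => vy.
have xy : connect e (inr x) (inr y) -> False.
  move=> xy; have := has_hidden_neq vm yx.
  by have [->] := connect_antisym (has_hidden_connect yx) xy; rewrite eqxx.
case: vx vy => [->//|[u [-> uu0 ux]]] /first_observed[y' [uy' y'y]].
have y'x : y' != x by apply/eqP => y'x; apply: xy; rewrite -y'x.
have := blm_admissible vm uu0 y'x (connect_trans y'y (has_hidden_connect yx)).
by rewrite uy' ux.
Qed.

Definition gobs iv z : obs X -> bool := fun y => gval iv z (inr y).

(** The weight [psi] sees only the parents of [x] in [G']. By [hidden_cause_parent] it ignores the
    responses of [x] and of the hidden nodes eliminated on the way, so unrolling is legitimate under
    this weight. *)
Lemma obs_mean iv x (psi : {ffun obs X -> bool} -> R) : iv x = None ->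
  gE (fun z => (gobs iv z x)%:R * psi (parmask tedge x (gobs iv z))) =
  \sum_y hidden_paths_weight m (inr y) x *
     gE (fun z => (gobs iv z y)%:R * psi (parmask tedge x (gobs iv z))) +
  hidden_paths_weight m u0 x * gE (fun z => psi (parmask tedge x (gobs iv z))).
Proof.
move=> ivx; pose g z := psi (parmask tedge x (gobs iv z)).
have := @hidden_unroll _ _ _ _ _ _ m vm (fun v => gE (fun z => (gval iv z v)%:R * g z)) x.
rewrite -/(gobs iv); rewrite /gobs => ->.
  congr (_ + _ * _); apply: eq_prodE => z; by rewrite (gval_u0 vm) mul1r.
move=> v vx; apply: gval_mean => //.
- case: vx => [->//|[u [-> uu0 _]]]; apply: contra uu0 => /eqP[->].
  by rewrite eqxx.
- case: vx => [->//|[u [-> uu0 _]]]; by rewrite /= (negbTE uu0).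
- move=> z b; rewrite /g; congr psi; apply: eq_parmask => y yx.
  rewrite /gobs /gval scm_val_upd//; first exact: (blm_acyclic vm).
  exact: hidden_cause_parent yx.
Qed.

Lemma gE_cst c : gE (fun=> c) = c.
Proof. exact: (prodE_cst (node_law_pmf m)). Qed.

Lemma gE01 iv v : 0 <= gE (fun z => (gval iv z v)%:R) <= 1.
Proof.
apply/andP; split.
  by rewrite -[0](gE_cst 0); apply: (ler_prodE (node_law_pmf m)) => z _; rewrite ler0n.
rewrite -[leRHS](gE_cst 1); apply: (ler_prodE (node_law_pmf m)) => z _.
by rewrite lern1 leq_b1.
Qed.

Lemma eq_gE g h : g =1 h -> gE g = gE h.
Proof. exact: eq_prodE. Qed.

Lemma gE_mean iv x : iv x = None ->
  gE (fun z => (gobs iv z x)%:R) =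
  \sum_y hidden_paths_weight m (inr y) x * gE (fun z => (gobs iv z y)%:R) +
  hidden_paths_weight m u0 x.
Proof.
move=> ivx; have := obs_mean (fun=> 1) ivx; rewrite gE_cst mulr1.
rewrite (@eq_gE _ (fun z => (gobs iv z x)%:R)) => [->|z]; last by rewrite mulr1.
congr (_ + _); apply: eq_bigr => y _; congr (_ * _); apply: eq_gE => z.
by rewrite mulr1.
Qed.

Lemma gobs_forced iv z y b : iv y = Some b -> gobs iv z y = b.
Proof. by move=> ivy; apply: (scm_val_forced (blm_acyclic vm)). Qed.

Lemma hidden_paths_weight_self x : hidden_paths_weight m (inr x) x = 0.
Proof.
apply: hidden_paths_weight_eq0; apply/negP => /(has_hidden_neq vm).
by rewrite eqxx.
Qed.

(** With all other observed nodes forced to 0, only the term of the constant source survives in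
    [gE_mean]. *)
Lemma tweight_None_hidden x : tweight m None x = hidden_paths_weight m u0 x.
Proof.
rewrite (tweight_NoneE vm).
have := @gE_mean (do_zeros_but x) x; rewrite {1}/do_zeros_but eqxx => /(_ erefl).
rewrite big1 ?add0r// => y _; have [->|yx] := eqVneq y x.
  by rewrite hidden_paths_weight_self mul0r.
rewrite (@eq_gE _ (fun=> 0)) ?gE_cst ?mulr0// => z.
by rewrite (@gobs_forced _ z y false)// /do_zeros_but (negbTE yx).
Qed.

(** The sum may run over all observed nodes because [tweight] vanishes on those that are not parents
    of [x]. *)
Definition tlin (x : obs X) (s : obs X -> bool) : R :=
  tweight m None x + \sum_y tweight m (Some y) x * (s y)%:R.

(** For [psi] the indicator of a configuration, this identifies [tlin] as the conditional mean of
    [x] given its parents in [G'], under every intervention that leaves [x] free. *)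
Lemma gE_tlin iv x psi : iv x = None ->
  gE (fun z => (gobs iv z x)%:R * psi (parmask tedge x (gobs iv z))) =
  gE (fun z => tlin x (gobs iv z) * psi (parmask tedge x (gobs iv z))).
Proof.
move=> ivx; rewrite obs_mean// -tweight_None_hidden /tlin.
rewrite (@eq_gE (fun z => _ * _) (fun z =>
  \sum_y hidden_paths_weight m (inr y) x *
    ((gobs iv z y)%:R * psi (parmask tedge x (gobs iv z))) +
  tweight m None x * psi (parmask tedge x (gobs iv z)))); last first.
  move=> z; rewrite mulrDl addrC big_distrl; congr (_ + _).
  by apply: eq_bigr => y _; rewrite /= mulrA.
rewrite /roundE prodED prodEZ prodE_sum; congr (_ + _).
by apply: eq_bigr => y _; rewrite prodEZ.
Qed.

Definition set_others (x : obs X) (s : obs X -> bool) : intervention X :=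
  fun y => if y == x then None else Some (s y).

(** The extreme values of the linear part of [x] in [G] over the states with [hid0] on. Being values
    at genuine states, both are fixed by [obsF]. *)
Definition lin_lo x := linear_part m (inr x) (pred1 u0).
Definition lin_hi x := linear_part m (inr x) xpredT.

Lemma gE_val_u0 iv : gE (fun z => (gval iv z u0)%:R) = 1.
Proof. by rewrite -[RHS](gE_cst 1); apply: eq_gE => z; rewrite (gval_u0 vm). Qed.

Lemma tlin_gE x s : tlin x s = gE (fun z => (gobs (set_others x s) z x)%:R).
Proof.
rewrite gE_mean /set_others ?eqxx// /tlin tweight_None_hidden addrC; congr (_ + _).
apply: eq_bigr => y _; have [->|yx] := eqVneq y x.
  by rewrite /= hidden_paths_weight_self !mul0r.
rewrite (@eq_gE _ (fun=> (s y)%:R)) ?gE_cst// => z.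
by rewrite (@gobs_forced _ z y (s y))// (negbTE yx).
Qed.

Lemma tlin_bounds x s : lin_lo x <= tlin x s <= lin_hi x.
Proof.
(* With the other observed nodes forced to [s], the mean of [x] is its linear part at the means of
   its parents in [G], which lie in [0, 1]. *)
have E : tlin x s = \sum_(w | e w (inr x)) weight m w (inr x) *
     gE (fun z => (gval (set_others x s) z w)%:R).
  rewrite tlin_gE; have := @gval_mean _ _ _ _ _ _ m vm (set_others x s) (inr x) (fun=> 1).
  rewrite /= {1}/set_others eqxx => /(_ erefl erefl (fun _ _ => erefl)).
  rewrite (@eq_gE _ (fun z => (gobs (set_others x s) z x)%:R)) => [->|z]; last first.
    by rewrite mulr1.
  by apply: eq_bigr => w _; congr (_ * _); apply: eq_gE => z; rewrite mulr1.
rewrite E; apply/andP; split; apply: ler_sum => w wx;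
  have /andP[w0 w1] := blm_weight01 vm wx; apply: ler_wpM2l => //;
  have /andP[g0 g1] := gE01 (set_others x s) w => //=.
by case: (eqVneq w u0) => [->|//]; rewrite gE_val_u0.
Qed.

Lemma lin_bounds x : 0 <= lin_lo x /\ lin_hi x <= 1.
Proof.
split.
  by have /andP[] := @linear_part01 _ _ _ _ _ _ m vm (inr x) (pred1 u0) erefl (eqxx _).
by have /andP[] := @linear_part01 _ _ _ _ _ _ m vm (inr x) xpredT erefl erefl.
Qed.

Lemma tlin01 x s : 0 <= tlin x s <= 1.
Proof. have := tlin_bounds x s; have := lin_bounds x; lra. Qed.

Lemma path_weight_ge0 a p : path e a p -> 0 <= path_weight m a p.
Proof.
elim: p a => //= b p IH a /andP[ab bp]; rewrite mulr_ge0 ?IH//.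
by have /andP[] := blm_weight01 vm ab.
Qed.

Lemma hidden_paths_weight_ge0 a x : 0 <= hidden_paths_weight m a x.
Proof.
by do 2 (apply: sumr_ge0 => ? ?); exact: path_weight_ge0.
Qed.

Lemma tweight01 z x : 0 <= tweight m z x <= 1.
Proof.
have t0 : 0 <= tweight m None x by rewrite tweight_None_hidden hidden_paths_weight_ge0.
case: z => [y|].
  apply/andP; split; first exact: hidden_paths_weight_ge0.
  have := tlin01 x (pred1 y); rewrite /tlin (bigD1 y)//= eqxx mulr1 big1 ?addr0.
    by case/andP => _; apply: le_trans; rewrite lerDr.
  by move=> i /negbTE ->; rewrite mulr0.
have := tlin01 x xpred0; rewrite /tlin big1 ?addr0// => i _.
by rewrite mulr0.
Qed.

Definition obsF x (y : R) := hitF (noise m 0 (inr x)) (thresh m 0 (inr x)) y.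

Let block_lawF x : forall C : set (R * R), measurable C ->
  P ((fun w => (noise m 0 (inr x) w, thresh m 0 (inr x) w)) @^-1` C) =
  (distribution P (noise m 0 (inr x)) \x distribution P (thresh m 0 (inr x)))%E C.
Proof.
move=> C mC; exact: (@block_law _ _ _ P _ _ (fun i : nat * gnode => noise m i.1 i.2)
  (fun i => thresh m i.1 i.2) (noise_indep vm) (0%N, inr x)).
Qed.

Lemma obsF_le x y z : y <= z -> obsF x y <= obsF x z.
Proof. by apply: hitF_le; [exact: block_lawF|exact: (blm_thresh_law vm)]. Qed.

Lemma obsF_lip x y z : y <= z -> obsF x z <= obsF x y + (z - y).
Proof. by apply: hitF_lip; [exact: block_lawF|exact: (blm_thresh_law vm)]. Qed.

Lemma obsF_lo x : obsF x (lin_lo x) = lin_lo x.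
Proof. by apply: (node_hitF_id vm) => //=; rewrite eqxx. Qed.

Lemma obsF_hi x : obsF x (lin_hi x) = lin_hi x.
Proof. exact: (node_hitF_id vm). Qed.

(** A map of slope at most 1 that fixes both ends of an interval fixes every point of it; hence
    truncation does not act at the true parameters. *)
Lemma obsF_tlin x s : obsF x (tlin x s) = tlin x s.
Proof.
have /andP[lo hi] := tlin_bounds x s.
have := obsF_lip x lo; have := obsF_lip x hi; rewrite obsF_lo obsF_hi; lra.
Qed.

(** Above [lin_lo x] truncation can only lower the probability; below it, monotonicity gives the
    bound [lin_lo x], which is at most [tlin x s]. *)
Lemma obsF_max x s y : obsF x y <= Num.max y (tlin x s).
Proof.
have /andP[lo hi] := tlin_bounds x s; rewrite le_max.
case: (leP (lin_lo x) y) => [ly|/ltW yl].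
  by have := obsF_lip x ly; rewrite obsF_lo => H; apply/orP; left; lra.
by have := obsF_le x yl; rewrite obsF_lo => H; apply/orP; right; lra.
Qed.

Definition plin (th : tparams m) x (s : obs X -> bool) : R :=
  dotv (th x) (par_vec m x s).

Lemma sum_tpar (x : obs X) (f : tnode X -> R) :
  \sum_(j < #|tpar m x|) f (enum_val j) = f None + \sum_(y | tedge y x) f (Some y).
Proof.
rewrite -(big_enum_val f) /= (bigD1 None)/=; last by rewrite inE.
congr (_ + _).
rewrite (reindex_omap Some id)/=; last by move=> [y|] //=; rewrite ?eqxx ?andbF.
by apply: eq_bigl => y; rewrite !inE eqxx !andbT.
Qed.

Lemma plin_true x s : plin (true_tparams m) x s = tlin x s.
Proof.
rewrite /plin /dotv mxE /tlin.
under eq_bigr do rewrite !mxE.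
rewrite (sum_tpar x (fun z => tweight m z x * (with_one s z)%:R)) mulr1; congr (_ + _).
rewrite big_mkcond; apply: eq_bigr => y _; case: ifPn => // /hidden_paths_weight_eq0.
by rewrite /= => ->; rewrite mul0r.
Qed.

Lemma plin_parmask th x s : plin th x (parmask tedge x s) = plin th x s.
Proof.
rewrite /plin; congr (dotv _ _); apply/matrixP => j k; rewrite !mxE.
have := enum_valP j; case: (enum_val j) => //= y; rewrite inE ffunE.
by rewrite /tedge => ->.
Qed.

Lemma eq_plin th x s s' : s =1 s' -> plin th x s = plin th x s'.
Proof.
move=> ss; rewrite -(plin_parmask th x s) -(plin_parmask th x s').
by congr plin; apply/funext => y; rewrite !ffunE ss.
Qed.

Definition tresp (th : tparams m) (x : obs X) : R * R -> response (V := obs X) :=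
  thr_resp (fun s : {ffun obs X -> bool} => plin th x s).

Local Notation noises := (fun i : nat * gnode => noise m i.1 i.2).
Local Notation threshs := (fun i : nat * gnode => thresh m i.1 i.2).

Definition tlaw th : obs X -> response (V := obs X) -> R :=
  element_law noises threshs xpredT (fun x => (0%N, inr x)) (tresp th)
    (fun=> [ffun=> true]).

Lemma tlaw_pmf th x : is_pmf (tlaw th x).
Proof. by apply: element_law_pmf => i z; exact: measurable_thr_resp. Qed.

Definition tstate S := scm_val tedge (@do_ones X S).

Lemma sigma'E S th : sigma' S th = prodE (tlaw th) (fun z => (tstate S z None)%:R).
Proof.
pose Z : Omega -> {ffun obs X -> response (V := obs X)} :=
  elements noises threshs xpredT (fun x => (0%N, inr x)) (tresp th) (fun=> [ffun=> true]).
pose f (z : {ffun obs X -> response (V := obs X)}) : R := (tstate S z None)%:R.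
have -> : sigma' S th = fine ('E_P[fun w => f (Z w)])%E.
  rewrite /sigma'; congr (fine 'E_P[_]); apply/funext => w; rewrite /f.
  congr (nat_of_bool _)%:R.
  suff : tvalue th S w =1 tstate S (Z w) by exact.
  rewrite /tvalue /tstate /scm_val; elim: #|obs X| => // n IH x /=.
  rewrite /tstep /scm_step; case: (do_ones S x) => //.
  by rewrite !ffunE/= plin_parmask -(eq_plin th x IH).
rewrite (expectation_elements (noise_indep vm))//.
- by move=> x y [].
- by move=> i z; exact: measurable_thr_resp.
Qed.

Lemma tlaw_mean th x (s : obs X -> bool) :
  resp_mean (tlaw th x) (parmask tedge x s) = obsF x (plin th x s).
Proof.
rewrite /resp_mean.
have := @thr_resp_mean R _ _ _ P _ noises threshs _ xpredT
  (fun x : obs X => (0%N, inr x : gnode))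
  (fun x (s : {ffun obs X -> bool}) => plin th x s)
  (fun=> [ffun=> true]) x (parmask tedge x s) erefl.
by move=> ->; rewrite plin_parmask.
Qed.

Lemma tstate_mean S th x (g : {ffun obs X -> response (V := obs X)} -> R) :
  do_ones S x = None -> (forall z b, g (upd z x b) = g z) ->
  prodE (tlaw th) (fun z => (tstate S z x)%:R * g z) =
  prodE (tlaw th) (fun z => obsF x (plin th x (tstate S z)) * g z).
Proof.
move=> Sx gu; rewrite (scm_mean tedge_acyclic (tlaw_pmf th) Sx gu).
by apply: eq_prodE => z; rewrite tlaw_mean.
Qed.

(** Both families of means obey the same linear recursion in topological order. *)
Lemma tstate_mean_true S x :
  prodE (tlaw (true_tparams m)) (fun z => (tstate S z x)%:R) =
  gE (fun z => (gobs (do_ones S) z x)%:R).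
Proof.
elim/(rank_ind tedge_acyclic): x => x IH.
case Sx: (do_ones S x) => [b|].
  rewrite (@eq_prodE _ _ _ _ _ (fun=> b%:R)); last first.
    by move=> z; rewrite /tstate (scm_val_forced tedge_acyclic _ Sx).
  rewrite (prodE_cst (tlaw_pmf _)) (@eq_gE _ (fun=> b%:R)) ?gE_cst// => z.
  by rewrite (gobs_forced _ Sx).
transitivity (prodE (tlaw (true_tparams m)) (fun z => tlin x (tstate S z))).
  have := tstate_mean (true_tparams m) (g := fun=> 1) Sx (fun _ _ => erefl).
  rewrite (@eq_prodE _ _ _ _ _ (fun z => (tstate S z x)%:R)) => [->|z]; last by rewrite mulr1.
  by apply: eq_prodE => z; rewrite mulr1 plin_true obsF_tlin.
rewrite gE_mean// /tlin prodED prodE_sum (prodE_cst (tlaw_pmf _)) addrC.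
rewrite tweight_None_hidden; congr (_ + _); apply: eq_bigr => y _; rewrite prodEZ.
case: (boolP (tedge y x)) => [/IH ->//|].
by rewrite /tedge => /hidden_paths_weight_eq0 /= ->; rewrite !mul0r.
Qed.

Lemma sigma'_true S : sigma' S (true_tparams m) = expected_Y m S.
Proof. by rewrite sigma'E tstate_mean_true expected_YE. Qed.

End Transformed.

(** * Histories *)

Section Histories.
Context {R : realType} {d} {Omega : measurableType d} {P : probability Omega R}.
Context {U X : finType} (m : blm P U X).
Hypothesis vm : valid_blm m.

Local Notation gnode := (node U X).
Local Notation u0 := (@hidden_node U X (hid0 m)).
Local Notation round_state := {ffun gnode -> response (V := gnode)}.
Local Notation noises := (fun i : nat * gnode => noise m i.1 i.2).
Local Notation threshs := (fun i : nat * gnode => thresh m i.1 i.2).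

Definition observed (S : {set X}) (z : round_state) : {ffun obs X -> bool} :=
  [ffun x => gobs m (do_ones S) z x].

(** An iterated expectation, one round at a time given the history, so that supermartingale
    arguments become inductions on [t]. *)
Fixpoint histE (pol : policy X) (t : nat) (g : history X -> R) : R :=
  if t is t'.+1 then
    histE pol t' (fun h => roundE m (fun z => g (rcons h (pol h, observed (pol h) z))))
  else g [::].

Definition round_law (z : round_state) : R := \prod_v node_law m v (z v).

Lemma round_law_pmf : is_pmf round_law.
Proof.
split=> [z|]; first exact: (prod_pmf_ge0 (node_law_pmf m)).
rewrite -[RHS](prodE1 (node_law_pmf m)); apply: eq_bigr => z _; by rewrite mulr1.
Qed.

Section Horizon.
Context (T : nat).

(** Index [t] is the played round [t.+1]. One round more than the horizon is kept so that the index
    type is inhabited and [inord] applies. *)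
Definition rounds (w : Omega) : {ffun 'I_T.+1 -> round_state} :=
  [ffun t : 'I_T.+1 => round_resp m t.+1 w].

Lemma expectation_rounds (g : {ffun 'I_T.+1 -> round_state} -> R) :
  ('E_P[fun w => g (rounds w)] = (prodE (fun=> round_law) g)%:E)%E.
Proof.
pose F := response (V := gnode).
(* The rounds are read as a single family indexed by pairs of a round and a node, to which joint
   independence applies. *)
pose curry (z : {ffun 'I_T.+1 * gnode -> F}) : {ffun 'I_T.+1 -> round_state} :=
  [ffun t => [ffun v => z (t, v)]].
pose uncurry (z : {ffun 'I_T.+1 -> round_state}) : {ffun 'I_T.+1 * gnode -> F} :=
  [ffun i => z i.1 i.2].
pose Z := elements noises threshs (fun i : 'I_T.+1 * gnode => i.2 != u0)
  (fun i => (i.1.+1, i.2)) (fun i => node_resp m i.2) (fun i => resp0 i.2).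
have -> : (fun w => g (rounds w)) = (fun w => (g \o curry) (Z w)).
  apply/funext => w /=; congr g; apply/ffunP => t; apply/ffunP => v.
  by rewrite !ffunE.
rewrite (expectation_elements (noise_indep vm))//; last 2 first.
- by move=> [t v] [t' v'] /= [tt vv]; congr pair => //; apply: val_inj.
- by move=> i z; exact: measurable_thr_resp.
congr EFin; rewrite /prodE (reindex uncurry)/=; last first.
  exists curry => z _; first by apply/ffunP => t; apply/ffunP => v; rewrite !ffunE.
  by apply/ffunP => -[t v]; rewrite !ffunE.
apply: eq_bigr => z _; congr (_ * g _); last first.
  by apply/ffunP => t; apply/ffunP => v; rewrite !ffunE.
rewrite /round_law pair_bigA/=; apply: eq_bigr => -[t v] _ /=.
by rewrite ffunE -(node_law_atE vm t.+1).
Qed.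

Fixpoint run_rounds (pol : policy X) (z : {ffun 'I_T.+1 -> round_state}) t : history X :=
  if t is t'.+1 then
    let h := run_rounds pol z t' in
    rcons h (pol h, observed (pol h) (z (inord t')))
  else [::].

Lemma run_roundsE pol t w : (t <= T.+1)%N -> run m pol t w = run_rounds pol (rounds w) t.
Proof.
elim: t => [//|t IH] tT; cbn [run run_rounds]; rewrite (IH (ltnW tT)).
set h := run_rounds _ _ t; suff -> : observed (pol h) (rounds w (inord t)) =
  [ffun x => obs_value m (do_ones (pol h)) t.+1 w x] by [].
apply/ffunP => x; rewrite !ffunE inordK//.
by rewrite /obs_value blm_valueE.
Qed.

Lemma run_rounds_upd pol z (i : 'I_T.+1) b t : (t <= i)%N ->
  run_rounds pol (upd z i b) t = run_rounds pol z t.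
Proof.
elim: t => //= t IH ti; rewrite IH ?(ltnW ti)//.
have tT : (t < T.+1)%N := leq_trans ti (ltnW (ltn_ord i)).
by rewrite ffunE; case: eqP => // ii; move: ti; rewrite -ii inordK ?ltnn.
Qed.

(** The latest round can be resampled without changing the history before it. *)
Lemma histE_rounds pol t g : (t <= T.+1)%N ->
  prodE (fun=> round_law) (fun z => g (run_rounds pol z t)) = histE pol t g.
Proof.
elim: t g => [|t IH] g tT.
  exact: (prodE_cst (fun=> round_law_pmf) (g [::])).
rewrite (prodE_resample (fun=> round_law_pmf) (inord t)) [RHS]/= -IH ?(ltnW tT)//.
apply: eq_prodE => z; apply: eq_bigr => b _ /=; congr (_ * g _).
by rewrite run_rounds_upd ?inordK// ffunE eqxx.
Qed.

End Horizon.

Lemma expectation_run pol T (f : 'I_T -> history X -> R) :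
  ('E_P[fun w => (\sum_(t < T) f t (run m pol t w))%R] =
   (\sum_(t < T) histE pol t (f t))%R%:E)%E.
Proof.
have -> : (fun w => \sum_(t < T) f t (run m pol t w)) =
    (fun w => (fun z => \sum_(t < T) f t (run_rounds pol z t)) (rounds T w)).
  apply/funext => w; apply: eq_bigr => t _; rewrite (run_roundsE (T := T))//.
  by rewrite ltnW// ltnS ltnW.
rewrite (expectation_rounds (fun z => \sum_(t < T) f t (run_rounds pol z t))).
congr EFin; rewrite prodE_sum; apply: eq_bigr => t _.
by apply: histE_rounds; rewrite ltnW// ltnS ltnW.
Qed.

Lemma regretE Sopt pol T : regret m Sopt pol T =
  (\sum_(t < T) histE pol t (fun h => expected_Y m Sopt - expected_Y m (pol h)))%:E.
Proof. exact: (expectation_run pol (fun=> _)). Qed.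

Lemma ler_histE pol t g g' : (forall h, size h = t -> g h <= g' h) ->
  histE pol t g <= histE pol t g'.
Proof.
elim: t g g' => [|t IH] g g' gg /=; first exact: gg.
apply: IH => h ht; apply: (ler_prodE (node_law_pmf m)) => z _.
by apply: gg; rewrite size_rcons ht.
Qed.

Lemma eq_histE pol t g g' : (forall h, size h = t -> g h = g' h) ->
  histE pol t g = histE pol t g'.
Proof. by move=> gg; apply/eqP; rewrite eq_le !ler_histE// => h /gg ->. Qed.

Lemma histE_cst pol t c : histE pol t (fun=> c) = c.
Proof.
elim: t => //= t IH; rewrite -[RHS]IH; apply: eq_histE => h _.
exact: gE_cst.
Qed.

Lemma histED pol t g g' :
  histE pol t (fun h => g h + g' h) = histE pol t g + histE pol t g'.
Proof.
elim: t g g' => //= t IH g g'; rewrite -IH; apply: eq_histE => h _.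
exact: prodED.
Qed.

Lemma histEZ pol t c g : histE pol t (fun h => c * g h) = c * histE pol t g.
Proof.
elim: t g => //= t IH g; rewrite -IH; apply: eq_histE => h _.
exact: prodEZ.
Qed.

Lemma histE_sum pol t (J : finType) (Q : pred J) (g : J -> history X -> R) :
  histE pol t (fun h => \sum_(j | Q j) g j h) = \sum_(j | Q j) histE pol t (g j).
Proof.
elim: t g => //= t IH g; rewrite -IH; apply: eq_histE => h _.
by rewrite /roundE prodE_sum.
Qed.

End Histories.

(** * Stability of the predicted mean *)

Lemma resp_mean1 {R : realType} {V : finType} (p : response (V := V) -> R) s :
  is_pmf p -> (resp_mean p s == 1) = [forall b, (0 < p b) ==> b s].
Proof.
move=> [p0 p1]; apply/eqP/forallP => [H b|H].
  have : \sum_b p b * (~~ b s)%:R = 0.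
    transitivity (\sum_b p b - resp_mean p s); last by rewrite p1 H subrr.
    rewrite /resp_mean -sumrB; apply: eq_bigr => b' _.
    by case: (b' s); rewrite ?mulr1 ?mulr0 ?subrr ?subr0.
  move/eqP; rewrite psumr_eq0 => [/allP/(_ b)|b' _]; last by rewrite mulr_ge0.
  rewrite mem_index_enum => /(_ isT) /=; case: (b s); rewrite ?implybT// mulr1 => /eqP ->.
  by rewrite ltxx.
rewrite -p1; apply: eq_bigr => b _; have := H b; rewrite lt_def p0 andbT.
by case: eqP => [->|_] /=; [rewrite mul0r|move=> ->; rewrite mulr1].
Qed.

Section Stability.
Context {R : realType} {d} {Omega : measurableType d} {P : probability Omega R}.
Context {U X : finType} (m : blm P U X).
Hypothesis vm : valid_blm m.

Local Notation gnode := (node U X).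
Local Notation u0 := (@hidden_node U X (hid0 m)).
Local Notation e := (edge m).
Local Notation round_state := {ffun gnode -> response (V := gnode)}.

Context (S : {set X}).
Local Notation iv := (do_ones S).

Definition sure (v : gnode) : bool :=
  [forall z : round_state, (0 < round_law m z) ==> gval m iv z v].

Lemma sureP v z : sure v -> 0 < round_law m z -> gval m iv z v.
Proof. by move=> /forallP/(_ z)/implyP. Qed.

Lemma pmf_pos {F : finType} (p : F -> R) : is_pmf p -> exists b, 0 < p b.
Proof.
move=> [p0 p1]; apply/existsP; apply: contraT; rewrite negb_exists => /forallP H.
have : \sum_b p b = 0.
  by apply: big1 => b _; apply/eqP; rewrite eq_le p0 andbT leNgt H.
by rewrite p1 => /eqP; rewrite oner_eq0.
Qed.

Lemma forced_do_ones v b : forced m iv v = Some b -> b.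
Proof.
case: v => [u|[x|]] //=; first by case: ifP => // _ [<-].
by case: ifP => // _ [<-].
Qed.

(** If all responses of positive probability switched [v] on when only its sure parents are on, the
    linear part would be 1 there and, weights being nonnegative, in every possible state; then [v]
    would be sure. *)
Lemma unsure_resp v : ~~ sure v ->
  exists b, 0 < node_law m v b /\ b (parmask e v sure) = false.
Proof.
move=> nv; have [z] : exists z, (0 < round_law m z) && ~~ gval m iv z v.
  by move: nv; rewrite negb_forall => /existsP[z]; rewrite negb_imply; exists z.
move=> /andP[z0 zv].
have vu0 : v != u0 by apply: contraNneq zv => ->; exact: (gval_u0 vm).
have ivv : forced m iv v = None.
  case E: (forced m iv v) => [b|//]; have b1 := forced_do_ones E.
  by rewrite /gval (scm_val_forced (blm_acyclic vm) _ E) b1 in zv.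
have su0 : sure u0 by apply/forallP => z'; rewrite (gval_u0 vm) implybT.
apply: contrapT => H; case/negP: zv.
have m1 : resp_mean (node_law m v) (parmask e v sure) == 1.
  rewrite resp_mean1; last exact: node_law_pmf.
  apply/forallP => b; apply/implyP => b0; apply: contraT => /negbTE bf.
  by exfalso; apply: H; exists b.
have : resp_mean (node_law m v) (parmask e v (gval m iv z)) == 1.
  rewrite eq_le (node_resp_mean vm)//; last exact: (gval_u0 vm).
  have /andP[_ ->] := linear_part01 vm (s := gval m iv z) vu0 (gval_u0 vm iv z).
  move: m1; rewrite (node_resp_mean vm)// => /eqP <-; apply: ler_sum => w wv.
  have /andP[w0 _] := blm_weight01 vm wv; apply: ler_wpM2l => //.
  by case: (boolP (sure w)) => //= sw; rewrite (sureP sw z0).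
rewrite resp_mean1; last exact: node_law_pmf.
move=> /forallP/(_ (z v)); rewrite /gval (scm_val_free (blm_acyclic vm))//.
move/implyP; apply; rewrite lt_neqAle eq_sym.
have [-> _] := node_law_pmf m v; rewrite andbT; apply: contraTneq z0 => zv0.
by rewrite /round_law (bigD1 v)//= zv0 mul0r ltxx.
Qed.

(* The pointwise smallest state compatible with [do S] has positive probability. *)
Lemma sure_state : exists2 z : round_state, 0 < round_law m z & gval m iv z =1 sure.
Proof.
have H v : exists b, 0 < node_law m v b /\ (sure v || (b (parmask e v sure) == false)).
  case: (boolP (sure v)) => [_|/unsure_resp[b [b0 bf]]].
    by have [b b0] := pmf_pos (node_law_pmf m v); exists b.
  by exists b; rewrite bf.
have [f Hf] := choice H; exists (finfun f).
  by apply: prodr_gt0 => v _; rewrite ffunE; case: (Hf v).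
have z0 : 0 < round_law m (finfun f).
  by apply: prodr_gt0 => v _; rewrite ffunE; case: (Hf v).
apply: (rank_ind (blm_acyclic vm)) => v IH.
case: (boolP (sure v)) => sv; first by rewrite (sureP sv z0).
have ivv : forced m iv v = None.
  case E: (forced m iv v) => [b|//]; have b1 := forced_do_ones E.
  case/negP: sv; apply/forallP => z; rewrite /gval.
  by rewrite (scm_val_forced (blm_acyclic vm) _ E) b1 implybT.
rewrite /gval (scm_val_free (blm_acyclic vm))// (eq_parmask (s' := sure)) => [|w wv].
  by rewrite ffunE; case: (Hf v) => _; rewrite (negbTE sv) => /eqP.
exact: IH.
Qed.

Definition osure (y : obs X) : bool := sure (inr y).

Lemma tlin_parmask x s : tlin m x (parmask (tedge m) x s) = tlin m x s.
Proof. by rewrite -!(plin_true m) plin_parmask. Qed.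

(** The parents of [x] are in their smallest configuration with positive probability. Given this,
    [x] is on almost surely, while its conditional mean is [tlin]. *)
Lemma tlin_osure x : iv x = None -> osure x -> tlin m x osure = 1.
Proof.
move=> ivx sx; have [z0 z0p z0E] := sure_state.
pose psi (c : {ffun obs X -> bool}) : R := (c == parmask (tedge m) x osure)%:R.
pose g z := psi (parmask (tedge m) x (gobs m iv z)).
have gz0 : g z0 = 1.
  rewrite /g /psi (eq_parmask (s' := osure)) ?eqxx// => w _.
  by rewrite /gobs z0E.
have g0 : 0 < roundE m g.
  rewrite /roundE /prodE (bigD1 z0)//= gz0 mulr1 ltr_wpDr//.
  by apply: sumr_ge0 => z _; rewrite mulr_ge0 ?ler0n// (prod_pmf_ge0 (node_law_pmf m)).
have := gE_tlin vm psi ivx; rewrite -/(gobs m iv).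
have -> : roundE m (fun z => (gobs m iv z x)%:R * g z) = roundE m g.
  apply: (eq_prodE_supp (node_law_pmf m)) => z zp.
  by rewrite /gobs (sureP sx zp) mul1r.
have -> : roundE m (fun z => tlin m x (gobs m iv z) * g z) = tlin m x osure * roundE m g.
  rewrite /roundE -prodEZ; apply: eq_prodE => z; rewrite /g /psi.
  case: eqP => [E|_]; last by rewrite !mulr0.
  by rewrite -(tlin_parmask x (gobs m iv z)) E tlin_parmask.
by move=> E; apply: (mulIf (lt0r_neq0 g0)); rewrite mul1r.
Qed.

Context (th : tparams m) (eta : R).
Hypothesis eta0 : 0 <= eta.
Hypothesis th01 : forall x j, 0 <= th x j 0 <= 1.
Hypothesis close : forall z x, 0 < round_law m z -> iv x = None ->
  `|plin th x (gobs m iv z) - tlin m x (gobs m iv z)| <= eta.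

Local Notation N := (#|obs X|).
Local Notation tE := (prodE (tlaw th)).
Local Notation tst := (tstate m S).

Lemma plinE x s :
  plin th x s = \sum_j th x j 0 * (with_one s (enum_val j))%:R.
Proof. by rewrite /plin /dotv mxE; apply: eq_bigr => j _; rewrite !mxE. Qed.

Lemma plin_le x (s s' : obs X -> bool) :
  (forall y, tedge m y x -> s y -> s' y) -> plin th x s <= plin th x s'.
Proof.
move=> ss; rewrite !plinE; apply: ler_sum => j _.
have /andP[t0 _] := th01 j; apply: ler_wpM2l => //.
have := enum_valP j; case: (enum_val j) => //= y; rewrite inE => yx.
by case: (boolP (s y)) => // /(ss y yx) ->.
Qed.

Lemma plin_ge0 x s : 0 <= plin th x s.
Proof.
rewrite plinE; apply: sumr_ge0 => j _; have /andP[t0 _] := th01 j.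
by rewrite mulr_ge0.
Qed.

Lemma plin_osure x : iv x = None -> tlin m x osure - eta <= plin th x osure.
Proof.
move=> ivx; have [z0 z0p z0E] := sure_state.
have := close z0p ivx.
have E : gobs m iv z0 =1 osure by move=> y; rewrite /gobs z0E.
rewrite (eq_plin th x E) -(plin_true m x (gobs m iv z0)) (eq_plin _ x E) (plin_true m).
by rewrite ler_norml => /andP[+ _]; lra.
Qed.

Definition tbad (z : {ffun obs X -> response (V := obs X)}) : bool :=
  ~~ [forall y, osure y ==> tst z y].

Definition sure_parents x (z : {ffun obs X -> response (V := obs X)}) : bool :=
  [forall y, (tedge m y x && osure y) ==> tst z y].

Lemma tE_cst c : tE (fun=> c) = c.
Proof. exact: (prodE_cst (tlaw_pmf th)). Qed.

Lemma sure_parents_upd x z b : sure_parents x (upd z x b) = sure_parents x z.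
Proof.
apply: eq_forallb => y; case: (boolP (tedge m y x)) => //= yx.
rewrite /tstate scm_val_upd//; first exact: (tedge_acyclic vm).
exact: (tedge_acyclic vm).
Qed.

(** With its sure parents on, the prediction of [th] at [x] is at least [1 - eta], and [obsF] maps 1
    to 1 with slope at most 1. *)
Lemma tE_fail x : iv x = None -> osure x ->
  tE (fun z => (~~ tst z x)%:R * (sure_parents x z)%:R) <= eta.
Proof.
move=> ivx sx.
have E1 : tE (fun z => (~~ tst z x)%:R * (sure_parents x z)%:R) =
   tE (fun z => (1 - obsF m x (plin th x (tst z))) * (sure_parents x z)%:R).
  have H := tstate_mean vm th (g := fun z => (sure_parents x z)%:R) ivx.
  have {H} := H (fun z b => congr1 (fun c : bool => c%:R) (sure_parents_upd x z b)).
  move=> H.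
  rewrite (@eq_prodE _ _ _ _ _ (fun z => (sure_parents x z)%:R +
     -1 * ((tst z x)%:R * (sure_parents x z)%:R))); last first.
    by move=> z; case: (tst z x); rewrite /=; ring.
  rewrite prodED prodEZ H -prodEZ -prodED; apply: eq_prodE => z; ring.
rewrite E1 -[leRHS]tE_cst; apply: (ler_prodE (tlaw_pmf th)) => z _.
case: (boolP (sure_parents x z)) => [/forallP Hp|_]; last by rewrite mulr0.
rewrite mulr1.
have le1 : plin th x osure <= plin th x (tst z).
  by apply: plin_le => y yx sy; have := Hp y; rewrite yx sy.
have := plin_osure ivx; rewrite tlin_osure// => le2.
have h1 : obsF m x (1 - eta) <= obsF m x (plin th x (tst z)).
  by apply: (obsF_le vm); lra.
have h2 : obsF m x 1 <= obsF m x (1 - eta) + (1 - (1 - eta)).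
  by apply: (obsF_lip vm); rewrite lerBlDr lerDl.
have := obsF_tlin vm x osure; rewrite tlin_osure// => h3; rewrite h3 in h2; lra.
Qed.

Lemma tE_bad : tE (fun z => (tbad z)%:R) <= N%:R * eta.
Proof.
apply: (@le_trans _ _ (tE (fun z => \sum_(x | osure x && (iv x == None))
    (~~ tst z x)%:R * (sure_parents x z)%:R))).
  apply: (ler_prodE (tlaw_pmf th)) => z _.
  case: (boolP (tbad z)) => [|_]; last by apply: sumr_ge0 => x _; rewrite mulr_ge0.
  move=> /= /negP bz.
  (* The topologically first sure node that is off is not forced and has its sure parents on; a
     union bound over this node follows. *)
  have [x Hx] : exists x, [&& osure x, iv x == None, ~~ tst z x & sure_parents x z].
    apply/existsP; apply: contraT; rewrite negb_exists => /forallP H; case: bz.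
    apply/forallP; apply: (rank_ind (tedge_acyclic vm)) => x IH.
    apply/implyP => sx; apply: contraT => nx; have := H x; rewrite sx nx /=.
    have -> /= : iv x == None.
      case E: (iv x) => [b|//]; move: nx; rewrite /tstate.
      rewrite (scm_val_forced (tedge_acyclic vm) _ E).
      by rewrite (@forced_do_ones (inr x) b E).
    case/negP; apply/forallP => y; apply/implyP => /andP[yx sy].
    by have := IH y yx; rewrite sy.
  case/and4P: Hx => sx ix nx px.
  rewrite (bigD1 x) ?sx//= nx px mulr1 lerDl.
  by apply: sumr_ge0 => y _; rewrite mulr_ge0.
rewrite prodE_sum (_ : N%:R * eta = \sum_(x : obs X) eta); last first.
  by rewrite sumr_const mulr_natl.
rewrite [leRHS](bigID (fun x => osure x && (iv x == None)))/=.
rewrite -[leLHS]addr0; apply: lerD; last exact: sumr_ge0.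
by apply: ler_sum => x /andP[sx /eqP ix]; exact: tE_fail.
Qed.

Definition tmu x := tE (fun z => (tst z x)%:R).
Definition gmu x := roundE m (fun z => (gobs m iv z x)%:R).

(** When all sure nodes are on, the prediction is at least [tlin x osure - eta], so the maximum in
    [obsF_max] costs at most [eta]; the bad event costs its probability. *)
Lemma tmu_step x : iv x = None ->
  tmu x <= tE (fun z => plin th x (tst z)) + (N%:R + 1) * eta.
Proof.
move=> ivx; rewrite /tmu.
have := tstate_mean vm th (g := fun=> 1) ivx (fun _ _ => erefl).
rewrite (@eq_prodE _ _ _ _ _ (fun z => (tst z x)%:R)) => [->|z]; last by rewrite mulr1.
apply: (@le_trans _ _ (tE (fun z => plin th x (tst z) + (eta + (tbad z)%:R)))); last first.
  by rewrite !prodED tE_cst; have := tE_bad; lra.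
apply: (ler_prodE (tlaw_pmf th)) => z _; rewrite mulr1.
have := obsF_max vm x osure (plin th x (tst z)).
move/le_trans; apply; rewrite ge_max; apply/andP; split.
  by rewrite lerDl addr_ge0.
case: (boolP (tbad z)) => [_|].
  have := plin_ge0 x (tst z); have /andP[_] := tlin01 vm x osure.
  by move: eta0; rewrite /=; lra.
rewrite negbK => /forallP good.
have : plin th x osure <= plin th x (tst z).
  by apply: plin_le => y _ sy; have := good y; rewrite sy.
have := plin_osure ivx; rewrite /=; lra.
Qed.

Lemma gmu_step x : iv x = None ->
  roundE m (fun z => plin th x (gobs m iv z)) <= gmu x + eta.
Proof.
move=> ivx; have H := gE_tlin vm (fun=> 1) ivx.
have {}H : gmu x = roundE m (fun z => tlin m x (gobs m iv z)).
  transitivity (roundE m (fun z => (gobs m iv z x)%:R * 1)).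
    by apply: eq_gE => z; rewrite mulr1.
  by rewrite H; apply: eq_gE => z; rewrite mulr1.
rewrite H -[eta in leRHS](gE_cst m) /roundE -prodED.
apply: (ler_prodE (node_law_pmf m)) => z zp.
by have := close zp ivx; rewrite ler_norml => /andP[_]; lra.
Qed.

(** Topological induction, with [M = N + 2] and [r] the rank of [x]: at most [N + 1] parents pass on
    an error of at most [M ^ r * eta] each, and the new error [M * eta] is at most [M ^ r * eta]
    since [r >= 1]. *)
Lemma tmu_gmu x : tmu x - gmu x <= (N%:R + 2) ^+ (rank (tedge m) x).+1 * eta.
Proof.
have M1 : 1 <= N%:R + 2 :> R by rewrite -[leLHS]add0r lerD// ler1n.
elim/(rank_ind (tedge_acyclic vm)): x => x IH.
case E: (iv x) => [b|].
  have -> : tmu x = b%:R.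
    rewrite -[RHS]tE_cst; apply: eq_prodE => z.
    by rewrite /tstate (scm_val_forced (tedge_acyclic vm) _ E).
  have -> : gmu x = b%:R.
    by rewrite -[RHS](gE_cst m); apply: eq_gE => z; rewrite (gobs_forced vm _ E).
  by rewrite subrr mulr_ge0// exprn_ge0//; lra.
have h1 := tmu_step E; have h2 := gmu_step E.
set r := rank (tedge m) x.
have r0 : (0 < r)%N by exact: rank_gt0.
have h3 : tE (fun z => plin th x (tst z)) - roundE m (fun z => plin th x (gobs m iv z)) <=
   (N%:R + 1) * ((N%:R + 2) ^+ r * eta).
  have -> : tE (fun z => plin th x (tst z)) =
      \sum_j th x j 0 * tE (fun z => (with_one (tst z) (enum_val j))%:R).
    under eq_prodE do rewrite plinE.
    by rewrite prodE_sum; apply: eq_bigr => j _; rewrite prodEZ.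
  have -> : roundE m (fun z => plin th x (gobs m iv z)) =
      \sum_j th x j 0 * roundE m (fun z => (with_one (gobs m iv z) (enum_val j))%:R).
    rewrite /roundE; under eq_prodE do rewrite plinE.
    by rewrite prodE_sum; apply: eq_bigr => j _; rewrite prodEZ.
  rewrite -sumrB.
  have b0 : 0 <= (N%:R + 2) ^+ r * eta by rewrite mulr_ge0// exprn_ge0//; lra.
  apply: (@le_trans _ _ (\sum_(j < #|tpar m x|) (N%:R + 2) ^+ r * eta)).
    apply: ler_sum => j _; rewrite -mulrBr.
    have /andP[t0 t1] := th01 j.
    have : tE (fun z => (with_one (tst z) (enum_val j))%:R) -
        roundE m (fun z => (with_one (gobs m iv z) (enum_val j))%:R) <= (N%:R + 2) ^+ r * eta.
      have := enum_valP j; case: (enum_val j) => [y|] /=; last first.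
        by rewrite tE_cst (gE_cst m) subrr.
      rewrite inE => yx; apply: le_trans (IH y yx) _; apply: ler_wpM2r => //.
      by apply: ler_weXn2l => //; exact: (edge_rank (tedge_acyclic vm)).
    move=> h; apply: (@le_trans _ _ (th x j 0 * ((N%:R + 2) ^+ r * eta))).
      exact: ler_wpM2l.
    by rewrite ler_piMl.
  rewrite sumr_const card_ord -[leLHS]mulr_natl; apply: ler_wpM2r => //.
  rewrite natr1 ler_nat (leq_trans (max_card _))//.
  by rewrite card_option.
have h4 : (N%:R + 2) * eta <= (N%:R + 2) ^+ r * eta.
  by apply: ler_wpM2r => //; rewrite -[leLHS]expr1; apply: ler_weXn2l.
have -> : (N%:R + 2) ^+ r.+1 * eta =
    (N%:R + 1) * ((N%:R + 2) ^+ r * eta) + (N%:R + 2) ^+ r * eta.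
  by rewrite exprS; ring.
lra.
Qed.

(* Hidden common causes can give the parents of a node different joint laws in
   [G] and in the transformed model, so [close], which concerns the laws of [G],
   says nothing about typical states of the transformed model. Only means are
   compared. Truncation of probabilities at 1 acts in the right direction, and
   truncation at 0 is excluded above the smallest state of [sure_state]. *)
Lemma sigma'_close : sigma' S th <= expected_Y m S + (N%:R + 2) ^+ N.+1 * eta.
Proof.
rewrite (sigma'E vm) (expected_YE vm) -lerBlDl; apply: le_trans (tmu_gmu None) _.
apply: ler_wpM2r => //; apply: ler_weXn2l; last by rewrite ltnS rank_le.
by rewrite -[leLHS]add0r lerD// ler1n.
Qed.

End Stability.

(** * Deviations of the regression noise *)

(** Squaring 1 - x/2 <= exp(-x/2) bounds exp(-x) from below; what remains is a polynomial
    inequality. *)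
Lemma expR_le_quadratic {R : realType} (x : R) : x <= 1 -> expR x <= 1 + x + 2 * x ^+ 2.
Proof.
move=> x1; have h0 : 0 < 1 - x / 2 by lra.
have h1 : 1 - x / 2 <= expR (- (x / 2)) by have := expR_ge1Dx (- (x / 2)); lra.
have h2 : (1 - x / 2) ^+ 2 <= expR (- x).
  have -> : - x = - (x / 2) + - (x / 2) by lra.
  rewrite expRD expr2; apply: ler_pM => //; exact: ltW.
have h3 : 1 <= (1 + x + 2 * x ^+ 2) * (1 - x / 2) ^+ 2.
  have -> : (1 + x + 2 * x ^+ 2) * (1 - x / 2) ^+ 2 =
    1 + x ^+ 2 * ((1 - x) * (5 / 4 - x / 2)) by field.
  by rewrite lerDl mulr_ge0 ?sqr_ge0// mulr_ge0//; lra.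
have q0 : 0 <= 1 + x + 2 * x ^+ 2 by nra.
have : 1 <= (1 + x + 2 * x ^+ 2) * expR (- x).
  by apply: le_trans h3 _; exact: ler_wpM2l.
by rewrite expRN ler_pdivlMr ?expR_gt0// mul1r.
Qed.

(** The left side is the moment generating function of a centred Bernoulli variable divided by
    exp(l^2/2), written as an affine function of [p]. The quadratic bound on exp gives 1 + 2 l^2
    p(1-p) for the former, and p(1-p) <= 1/4. *)
Lemma bernoulli_mgf {R : realType} (p l : R) : 0 <= p <= 1 -> -1 <= l <= 1 ->
  expR (- (l * p) - l ^+ 2 / 2) +
    p * (expR (l * (1 - p) - l ^+ 2 / 2) - expR (- (l * p) - l ^+ 2 / 2)) <= 1.
Proof.
move=> /andP[p0 p1] /andP[l0 l1].
rewrite !expRD; set v := expR (- (l ^+ 2 / 2)).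
have v0 : 0 < v by exact: expR_gt0.
have hv : v * (1 + l ^+ 2 / 2) <= 1.
  rewrite /v expRN mulrC ler_pdivrMr ?expR_gt0// mul1r; exact: expR_ge1Dx.
have h1 : expR (- (l * p)) <= 1 + - (l * p) + 2 * (- (l * p)) ^+ 2.
  by apply: expR_le_quadratic; nra.
have h2 : expR (l * (1 - p)) <= 1 + l * (1 - p) + 2 * (l * (1 - p)) ^+ 2.
  by apply: expR_le_quadratic; nra.
set a := expR (- (l * p)) in h1 *; set b := expR (l * (1 - p)) in h2 *.
have h3 : (1 - p) * a + p * b <= 1 + l ^+ 2 / 2.
  apply: (@le_trans _ _ ((1 - p) * (1 + - (l * p) + 2 * (- (l * p)) ^+ 2) +
     p * (1 + l * (1 - p) + 2 * (l * (1 - p)) ^+ 2))).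
    by apply: lerD; apply: ler_wpM2l => //; lra.
  have -> : (1 - p) * (1 + - (l * p) + 2 * (- (l * p)) ^+ 2) +
     p * (1 + l * (1 - p) + 2 * (l * (1 - p)) ^+ 2) =
     1 + 2 * l ^+ 2 * (p * (1 - p)) by ring.
  have : p * (1 - p) <= 1 / 4 by have := sqr_ge0 (p - 1 / 2); nra.
  by have := sqr_ge0 l; nra.
have -> : a * v + p * (b * v - a * v) = v * ((1 - p) * a + p * b) by ring.
by apply: le_trans hv; rewrite ler_wpM2l// ltW.
Qed.

Section DyadicGrid.
Context {R : realType} (L : nat).

Definition grid : finType := option (bool * 'I_L.+1).

Definition grid_val (g : grid) : R :=
  if g is Some (s, j) then (-1) ^+ s * (2 ^+ j)^-1 else 0.

Lemma grid_val1 g : -1 <= grid_val g <= 1.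
Proof.
rewrite -ler_norml; case: g => [[s j]|] /=; last by rewrite normr0.
rewrite normrM normrX normrN1 expr1n mul1r ger0_norm ?invr_ge0 ?exprn_ge0//.
by rewrite invf_le1 ?exprn_gt0// exprn_ege1// ler1n.
Qed.

Lemma card_grid : #|grid| = (L.*2 + 3)%N.
Proof. by rewrite card_option card_prod card_bool card_ord mul2n doubleS addn3. Qed.

(* Either the optimal [lam = S / N] is approximated within a factor 2 from
   below, or it is so small that [lam = 0] loses at most 1. *)
Lemma gridP (N S : R) : 0 <= N -> `|S| <= N -> N <= 2 ^+ L ->
  exists g, 3 / 8 * (S ^+ 2 / N) - 1 <= grid_val g * S - grid_val g ^+ 2 / 2 * N.
Proof.
rewrite le_eqVlt => /predU1P[<- _ _|N0 SN NL].
  by exists None; rewrite invr0 /=; lra.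
pose a := `|S| / N.
have a0 : 0 <= a by rewrite divr_ge0// ltW.
have a1 : a <= 1 by rewrite ler_pdivrMr// mul1r.
have SE : `|S| = a * N by rewrite /a divfK// gt_eqF.
have S2 : S ^+ 2 / N = a ^+ 2 * N.
  by rewrite -(real_normK (num_real S)) SE; field; rewrite gt_eqF.
have [aL|aL] := ltP a ((2 ^+ L)^-1).
  exists None; rewrite S2 /= !mul0r expr0n/= !mul0r subr0.
  suff : a ^+ 2 * N <= 1 by lra.
  have h1 : a * N <= 1.
    apply: (@le_trans _ _ ((2 ^+ L)^-1 * 2 ^+ L)); last by rewrite mulVf// expf_neq0.
    by apply: ler_pM => //; exact: ltW.
  by rewrite expr2 -mulrA; nra.
pose Q j := (2 ^+ j)^-1 <= a.
have exQ : exists j, Q j by exists L.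
have [j Qj jmin] := ex_minnP exQ.
have jL : (j < L.+1)%N by rewrite ltnS; apply: jmin.
have ta : (2 ^+ j)^-1 <= a := Qj.
set t := (2 ^+ j)^-1 in ta.
have t0 : 0 < t by rewrite invr_gt0 exprn_gt0.
have at2 : a <= 2 * t.
  case: j jmin {jL Qj} @t ta t0 => [|j] jmin t ta t0; first by rewrite /t expr0 invr1; lra.
  have : ~~ Q j by apply/negP => /jmin; rewrite ltnn.
  rewrite /Q -ltNge => /ltW; rewrite /t exprS invfM.
  by rewrite mulrA divff// mul1r.
exists (Some (S < 0, Ordinal jL)); rewrite S2 /=.
rewrite [in leRHS]exprMn sqrr_sign mul1r -/t.
have -> : (-1) ^+ (S < 0)%R * t * S = t * (a * N).
  rewrite -SE; have [S0|S0] := ltP S 0.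
    by rewrite ltr0_norm// expr1; ring.
  by rewrite ger0_norm// expr0; ring.
(* The right side is concave in [t]; it equals 3/8 a^2 at t = a/2 and at t = 3a/2, and [t] lies
   between. *)
have : 3 / 8 * a ^+ 2 <= t * a - t ^+ 2 / 2.
  have : 0 <= (t - a / 2) * (3 / 2 * a - t) by rewrite mulr_ge0//; lra.
  lra.
move=> h; have := ler_wpM2r (ltW N0) h; lra.
Qed.

End DyadicGrid.

Section Deviations.
Context {R : realType} {d} {Omega : measurableType d} {P : probability Omega R}.
Context {U X : finType} (m : blm P U X).
Hypothesis vm : valid_blm m.
Context (x : obs X).

Local Notation record := ({set X} * {ffun obs X -> bool})%type.
Local Notation config := {ffun obs X -> bool}.

Definition cfg (r : record) : config := parmask (tedge m) x r.2.

Definition err (r : record) : R := (r.2 x)%:R - tlin m x r.2.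

Lemma err_norm r : `|err r| <= 1.
Proof.
rewrite ler_norml /err; have := tlin01 vm x r.2.
by case: (r.2 x) => /=; lra.
Qed.

Lemma tlin_cfg r : tlin m x (cfg r) = tlin m x r.2.
Proof. by rewrite -!plin_true plin_parmask. Qed.

(** The exponential supermartingale of the regression noises at [x], with a separate tilt for each
    configuration of the parents. *)
Definition tilt (lam : config -> R) (h : history X) : R :=
  expR (\sum_(r <- h | free_in x r) (lam (cfg r) * err r - lam (cfg r) ^+ 2 / 2)).

Lemma histE_tilt pol t lam : (forall c, -1 <= lam c <= 1) ->
  histE m pol t (tilt lam) <= 1.
Proof.
move=> lam1; elim: t => [|t IH]; first by rewrite /= /tilt big_nil expR0.
apply: le_trans IH; rewrite /=; apply: ler_histE => h _.
set S := pol h; pose r z : record := (S, observed m S z).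
have tiltE z : tilt lam (rcons h (r z)) = tilt lam h *
    (if do_ones S x == None
     then expR (lam (cfg (r z)) * err (r z) - lam (cfg (r z)) ^+ 2 / 2) else 1).
  rewrite /tilt -cats1 big_cat big_cons big_nil/= /free_in/=.
  by case: ifP => _; rewrite addr0 ?expRD// mulr1.
rewrite (@eq_gE _ _ _ _ _ _ m _ _ tiltE) /roundE prodEZ -/(roundE m _).
rewrite -[leRHS]mulr1; apply: ler_wpM2l; first by apply: expR_ge0.
case: eqP => [Sx|_]; last by rewrite (gE_cst m).
(* The factor of the new round is [A + B * x], affine in the value of [x] with coefficients
   depending on the parents, so [gE_tlin] replaces [x] by its conditional mean. *)
pose A (c : config) := expR (- (lam c * tlin m x c) - lam c ^+ 2 / 2).
pose B (c : config) := expR (lam c * (1 - tlin m x c) - lam c ^+ 2 / 2) - A c.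
pose c z := parmask (tedge m) x (gobs m (do_ones S) z).
have cE z : cfg (r z) = c z.
  by apply/ffunP => y; rewrite /cfg /c !ffunE.
rewrite (@eq_gE _ _ _ _ _ _ m _
  (fun z => A (c z) + (gobs m (do_ones S) z x)%:R * B (c z))); last first.
  move=> z; rewrite /err -tlin_cfg !cE /r/= ffunE.
  case: (gobs m (do_ones S) z x); rewrite /= ?mul1r ?mul0r ?addr0 /B; last first.
    by congr expR; rewrite sub0r mulrN.
  by rewrite /A /=; ring.
rewrite /roundE prodED; have := gE_tlin vm B Sx; rewrite /roundE -/(c _) => ->.
rewrite -prodED -[leRHS](gE_cst m) /roundE; apply: (ler_prodE (node_law_pmf m)) => z _.
have -> : tlin m x (gobs m (do_ones S) z) = tlin m x (c z).
  by rewrite -!plin_true plin_parmask.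
by apply: bernoulli_mgf => //; exact: tlin01.
Qed.

Definition visits (h : history X) (c : config) : R :=
  \sum_(r <- h | free_in x r && (cfg r == c)) 1.

Definition err_sum (h : history X) (c : config) : R :=
  \sum_(r <- h | free_in x r && (cfg r == c)) err r.

Definition deviation (h : history X) : R := \sum_c err_sum h c ^+ 2 / visits h c.

Lemma err_sum_norm h c : `|err_sum h c| <= visits h c.
Proof.
apply: le_trans (ler_norm_sum _ _ _) _; apply: ler_sum => r _; exact: err_norm.
Qed.

Lemma visits_ge0 h c : 0 <= visits h c.
Proof. by apply: sumr_ge0. Qed.

Lemma visits_size h c : visits h c <= (size h)%:R.
Proof.
rewrite /visits big_const_seq iter_addr_0 ler_nat; exact: count_size.
Qed.

Lemma sum_config h (f : config -> R) (g : record -> R) :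
  \sum_(r <- h | free_in x r) f (cfg r) * g r =
  \sum_c f c * \sum_(r <- h | free_in x r && (cfg r == c)) g r.
Proof.
rewrite (partition_big cfg xpredT)//=; apply: eq_bigr => c _.
by rewrite big_distrr/=; apply: eq_bigr => r /andP[_ /eqP ->].
Qed.

Lemma deviation_tilt (L : nat) h : (size h <= 2 ^ L)%N ->
  exists f : {ffun config -> grid L},
    3 / 8 * deviation h - #|{: config}|%:R <=
    \sum_(r <- h | free_in x r)
       (grid_val (f (cfg r)) * err r - grid_val (f (cfg r)) ^+ 2 / 2).
Proof.
move=> hL.
have H c : exists g : grid L, 3 / 8 * (err_sum h c ^+ 2 / visits h c) - 1 <=
   grid_val g * err_sum h c - grid_val g ^+ 2 / 2 * visits h c.
  apply: gridP; [exact: visits_ge0|exact: err_sum_norm|].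
  by apply: le_trans (visits_size h c) _; rewrite -natrX ler_nat.
have [f Hf] := choice H; exists (finfun f).
rewrite sumrB (sum_config h (fun c => grid_val (finfun f c)) err).
under [X in _ <= _ - X]eq_bigr do rewrite -[_ / 2]mulr1.
rewrite (sum_config h (fun c => grid_val (finfun f c) ^+ 2 / 2) (fun=> 1)).
rewrite -sumrB /deviation big_distrr/= -sumr_const -sumrB.
by apply: ler_sum => c _; rewrite ffunE; exact: Hf.
Qed.

(** On the event, some assignment of grid tilts to configurations makes [tilt] exponentially large.
    The sum over all assignments has expectation at most their number, and Markov's inequality
    concludes. *)
Lemma deviation_prob pol t (L : nat) (rho2 : R) : (t <= 2 ^ L)%N ->
  histE m pol t (fun h => (rho2 < deviation h)%R%:R) <=
  expR (#|{: config}|%:R - 3 / 8 * rho2) * (L.*2 + 3)%:R ^+ #|{: config}|.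
Proof.
move=> tL.
pose W (f : {ffun config -> grid L}) := tilt (fun c => grid_val (f c)).
apply: (@le_trans _ _ (histE m pol t (fun h =>
    expR (#|{: config}|%:R - 3 / 8 * rho2) * \sum_f W f h))).
  apply: ler_histE => h ht; have W0 f : 0 <= W f h by exact: expR_ge0.
  case: ltP => [dev|_]; last by rewrite mulr_ge0 ?expR_ge0// sumr_ge0.
  have [|f Hf] := @deviation_tilt L h; first by rewrite ht.
  rewrite (bigD1 f)//= mulrDr -[leLHS]addr0; apply: lerD; last first.
    by rewrite mulr_ge0 ?expR_ge0// sumr_ge0.
  rewrite /W /tilt -expRD; apply: le_trans (expR_ge1Dx _).
  by rewrite lerDl; lra.
rewrite histEZ histE_sum; apply: ler_wpM2l; first by apply: expR_ge0.
apply: (@le_trans _ _ (\sum_(f : {ffun config -> grid L}) 1)).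
  by apply: ler_sum => f _; apply: histE_tilt => c; exact: grid_val1.
by rewrite sumr_const card_ffun card_grid natrX.
Qed.

End Deviations.

(** * Score equations and optimism *)

Section Regression.
Context {R : realType} {d} {Omega : measurableType d} {P : probability Omega R}.
Context {U X : finType} (m : blm P U X).
Hypothesis vm : valid_blm m.

Local Notation gnode := (node U X).
Local Notation round_state := {ffun gnode -> response (V := gnode)}.
Local Notation record := ({set X} * {ffun obs X -> bool})%type.

Section Visits.
Context (pol : policy X) (S : {set X}) (o : {ffun obs X -> bool}) (n : nat).

Definition visit_prob : R := roundE m (fun z => (observed m S z == o)%:R).

Definition nvisits (h : history X) : nat := count (pred1 (S, o)) h.

Lemma visit_prob_gt0 z : 0 < round_law m z -> observed m S z = o -> 0 < visit_prob.
Proof.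
move=> z0 zo; rewrite /visit_prob /roundE /prodE (bigD1 z)//= zo eqxx mulr1 ltr_wpDr//.
by apply: sumr_ge0 => z' _; rewrite mulr_ge0 ?ler0n// (prod_pmf_ge0 (node_law_pmf m)).
Qed.

(** The potential [minn (nvisits h) n] never exceeds [n], and each counted round raises it by
    [visit_prob] in conditional expectation. *)
Lemma nvisits_bound T :
  \sum_(t < T) histE m pol t (fun h => ((pol h == S) && (nvisits h < n)%N)%:R) *
    visit_prob <= n%:R.
Proof.
pose phi h : R := (minn (nvisits h) n)%:R.
apply: (@le_trans _ _ (histE m pol T phi)); last first.
  rewrite -[leRHS](histE_cst m pol T); apply: ler_histE => h _.
  by rewrite ler_nat geq_minr.
elim: T => [|T IH]; first by rewrite big_ord0 /= ler0n.
rewrite big_ord_recr/=; apply: le_trans (lerD IH (lexx _)) _.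
rewrite mulrC -histEZ -histED; apply: ler_histE => h _.
rewrite -[phi h](gE_cst m) [visit_prob * _]mulrC /visit_prob /roundE -prodEZ -prodED.
apply: (ler_prodE (node_law_pmf m)) => z _.
rewrite /phi /nvisits -cats1 count_cat/= addn0 xpair_eqE.
case: (pol h =P S) => [->|_] /=; last by rewrite mul0r addr0 ler_nat addn0.
rewrite -natrM -natrD ler_nat; case: (observed m S z == o); lia.
Qed.

End Visits.

Lemma dotvC k (a b : 'cV[R]_k) : dotv a b = dotv b a.
Proof. by rewrite /dotv !mxE; apply: eq_bigr => i _; rewrite !mxE mulrC. Qed.

Lemma dotvBl k (a b c : 'cV[R]_k) : dotv (a - b) c = dotv a c - dotv b c.
Proof. by rewrite /dotv linearB/= mulmxBl !mxE. Qed.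

Lemma dotv_sumr (I : Type) (s : seq I) (Q : pred I) k (a : 'cV[R]_k) (f : I -> 'cV[R]_k) :
  dotv a (\sum_(i <- s | Q i) f i) = \sum_(i <- s | Q i) dotv a (f i).
Proof. by rewrite /dotv mulmx_sumr summxE. Qed.

Lemma dotvZr k (a b : 'cV[R]_k) c : dotv a (c *: b) = c * dotv a b.
Proof. by rewrite /dotv -scalemxAr !mxE. Qed.

Definition sqdist (h : history X) (x : obs X) (v : 'cV[R]_#|tpar m x|) : R :=
  \sum_(r <- h | free_in x r) dotv v (par_vec m x r.2) ^+ 2.

Lemma gramE h x (v : 'cV[R]_#|tpar m x|) :
  (v^T *m gram m h x *m v) 0 0 = sqdist h v.
Proof.
rewrite /gram mulmx_sumr mulmx_suml summxE; apply: eq_bigr => r _.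
rewrite mulmxA -mulmxA mxE big_ord1 expr2; congr (_ * _).
by rewrite [LHS](dotvC (par_vec m x r.2)).
Qed.

Lemma sqdist_ge0 h x (v : 'cV[R]_#|tpar m x|) : 0 <= sqdist h v.
Proof. by apply: sumr_ge0 => r _; exact: sqr_ge0. Qed.

Lemma mnorm_le h x (v : 'cV[R]_#|tpar m x|) rho : 0 <= rho ->
  (mnorm (gram m h x) v <= rho) = (sqdist h v <= rho ^+ 2).
Proof.
move=> rho0; rewrite /mnorm gramE -[in RHS](sqr_sqrtr (sqdist_ge0 h v)).
by rewrite ler_sqr// nnegrE sqrtr_ge0.
Qed.

Lemma sqdistC h x (a b : 'cV[R]_#|tpar m x|) : sqdist h (a - b) = sqdist h (b - a).
Proof. by apply: eq_bigr => r _; rewrite !dotvBl -sqrrN opprB. Qed.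

Lemma sqdist_triangle h x (a b c : 'cV[R]_#|tpar m x|) :
  sqdist h (a - c) <= 2 * sqdist h (a - b) + 2 * sqdist h (b - c).
Proof.
rewrite /sqdist !big_distrr -big_split; apply: ler_sum => r _ /=.
rewrite !dotvBl; set p := dotv a _; set q := dotv b _; set s := dotv c _.
have := sqr_ge0 ((p - q) - (q - s)); nra.
Qed.

(* With [y c] the prediction error at configuration [c], the score equation
   reads [sum_c y c * S c = sum_c N c * (y c)^2]; AM-GM bounds its left side. *)
Lemma sqdist_score h x (hat : 'cV[R]_#|tpar m x|) : solves_score h hat ->
  sqdist h (hat - true_tparams m x) <= deviation m x h.
Proof.
move=> sc; set D := hat - true_tparams m x.
pose y (c : {ffun obs X -> bool}) := dotv D (par_vec m x c).
have yE (r : record) : dotv D (par_vec m x r.2) = y (cfg m x r).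
  rewrite /y; congr dotv; apply/matrixP => j k; rewrite !mxE.
  have := enum_valP j; case: (enum_val j) => //= z; rewrite inE ffunE.
  by rewrite /tedge => ->.
have E : \sum_(r <- h | free_in x r) y (cfg m x r) * err m x r =
         \sum_(r <- h | free_in x r) y (cfg m x r) ^+ 2 * 1.
  apply/eqP; rewrite -subr_eq0 -sumrB; apply/eqP.
  have := congr1 (dotv D) sc; rewrite dotv_sumr.
  have -> : dotv D 0 = 0 by rewrite /dotv mulmx0 mxE.
  move=> H0; rewrite -[RHS]H0; apply: eq_bigr => r _; rewrite dotvZr -yE /err -plin_true /plin.
  by rewrite (dotvC _ hat) [in RHS]mulrC /D dotvBl; ring.
have Z : sqdist h D = \sum_c y c ^+ 2 * visits m x h c.
  rewrite -(sum_config m x h (fun c => y c ^+ 2) (fun=> 1)); apply: eq_bigr => r _.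
  by rewrite yE mulr1.
have Z' : sqdist h D = \sum_c y c * err_sum m x h c.
  rewrite -sum_config E; apply: eq_bigr => r _; by rewrite yE mulr1.
suff : 2 * sqdist h D <= sqdist h D + deviation m x h by lra.
rewrite {1}Z' {1}Z /deviation big_distrr -big_split/=; apply: ler_sum => c _.
have := visits_ge0 m x h c; rewrite le_eqVlt => /predU1P[N0|N0].
  have := err_sum_norm vm x h c; rewrite -N0 normr_le0 => /eqP ->.
  by rewrite expr0n /= mul0r !mulr0 addr0.
have -> : y c ^+ 2 * visits m x h c + err_sum m x h c ^+ 2 / visits m x h c =
   2 * (y c * err_sum m x h c) +
   (y c * visits m x h c - err_sum m x h c) ^+ 2 / visits m x h c.
  by field; rewrite gt_eqF.
by rewrite lerDl divr_ge0 ?sqr_ge0// ltW.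
Qed.

Lemma nvisits_sqdist S o h x (v : 'cV[R]_#|tpar m x|) : do_ones S x = None ->
  (nvisits S o h)%:R * dotv v (par_vec m x o) ^+ 2 <= sqdist h v.
Proof.
move=> Sx; rewrite /sqdist; elim: h => [|r h IH]; first by rewrite /= mul0r big_nil.
rewrite big_cons /nvisits/= natrD mulrDl.
have [->|rS] := eqVneq r (S, o).
  by rewrite /free_in /= Sx eqxx /= mul1r lerD2l.
rewrite mul0r add0r; case: ifP => _ //; apply: le_trans IH _.
by rewrite lerDr sqr_ge0.
Qed.

Lemma truth_in_confidence h rho (hat : tparams m) : 0 <= rho ->
  (forall x, solves_score h (hat x)) -> (forall x, deviation m x h <= rho ^+ 2) ->
  in_confidence h rho hat (true_tparams m).
Proof.
move=> rho0 sc dev x; split=> [j|]; first by rewrite mxE; exact: tweight01.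
rewrite mnorm_le// sqdistC; apply: le_trans (dev x); exact: sqdist_score.
Qed.

(** The truth and [opt] are both within [rho] of [hat], so their squared distance is at most
    [4 * rho ^+ 2]. Each outcome visited [n] times then has prediction error at most [eta], and
    [sigma'_close] applies to [opt]. *)
Lemma optimistic_round (K : nat) (Sopt S : {set X}) (h : history X) (rho eta : R) (n : nat)
    (hat opt : tparams m) :
  (#|Sopt| <= K)%N -> 0 <= rho -> 0 < eta -> (0 < n)%N -> 4 * rho ^+ 2 <= n%:R * eta ^+ 2 ->
  (forall x, solves_score h (hat x)) -> (forall x, deviation m x h <= rho ^+ 2) ->
  in_confidence h rho hat opt ->
  (forall (S' : {set X}) (th : tparams m), (#|S'| <= K)%N -> in_confidence h rho hat th ->
     sigma' S' th <= sigma' S opt) ->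
  (forall o, 0 < visit_prob S o -> (n <= nvisits S o h)%N) ->
  expected_Y m Sopt <= expected_Y m S + (#|obs X|%:R + 2) ^+ #|obs X|.+1 * eta.
Proof.
move=> SK rho0 eta0 n0 neta sc dev copt best vis.
have ctrue := truth_in_confidence rho0 sc dev.
rewrite -(sigma'_true vm Sopt); apply: le_trans (best _ _ SK ctrue) _.
apply: (sigma'_close vm (eta := eta)); first exact: ltW.
  by move=> x j; have [] := copt x.
move=> z x z0 Sx; rewrite -plin_true /plin -dotvBl; set V := dotv _ _.
have n0' : 0 < n%:R :> R by rewrite ltr0n.
have : n%:R * V ^+ 2 <= n%:R * eta ^+ 2.
  apply: le_trans neta; set o := observed m S z.
  have no : (n <= nvisits S o h)%N by apply: vis; exact: visit_prob_gt0 z0 _.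
  apply: (@le_trans _ _ ((nvisits S o h)%:R * V ^+ 2)).
    by rewrite ler_wpM2r ?sqr_ge0// ler_nat.
  have VE : V = dotv (opt x - true_tparams m x) (par_vec m x o).
    rewrite /V; congr dotv; apply/matrixP => j k; rewrite !mxE /with_one.
    by case: (enum_val j) => // y; rewrite /o ffunE.
  rewrite VE; apply: le_trans (nvisits_sqdist o h _ Sx) _.
  apply: le_trans (sqdist_triangle h _ (hat x) _) _.
  have [_ c1] := copt x; have [_ c2] := ctrue x.
  rewrite mnorm_le// in c1; rewrite mnorm_le// sqdistC in c2; lra.
by rewrite ler_pM2l// -[V ^+ 2]real_normK ?num_real// ler_sqr// ?nnegrE// ltW.
Qed.

End Regression.

(** * Regret *)

Lemma pos_separation {R : realType} (I : finType) (f : I -> R) :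
  exists2 eta : R, 0 < eta & forall i, 0 < f i -> eta < f i.
Proof.
suff [eta e0 H] : exists2 eta : R, 0 < eta & forall i, i \in enum I -> 0 < f i -> eta < f i.
  by exists eta => // i; apply: H; rewrite mem_enum.
elim: (enum I) => [|i s [eta e0 IH]]; first by exists 1.
have [fi|fi] := ltP 0 (f i); last first.
  by exists eta => // j; rewrite inE => /predU1P[->|/IH//]; rewrite ltNge fi.
exists (Num.min eta (f i / 2)); first by rewrite lt_min e0 divr_gt0.
move=> j; rewrite inE gt_min => /predU1P[->|/IH{}IH /IH ->//] _.
by apply/orP; right; lra.
Qed.

Section RegretBound.
Context {R : realType} {d} {Omega : measurableType d} {P : probability Omega R}.
Context {U X : finType} (m : blm P U X).
Hypothesis vm : valid_blm m.

Local Notation config := {ffun obs X -> bool}.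
Local Notation slack := ((#|obs X|%:R + 2) ^+ #|obs X|.+1 : R).

Lemma expected_Y01 S : 0 <= expected_Y m S <= 1.
Proof. by rewrite (expected_YE vm); exact: gE01. Qed.

Context (K : nat) (Sopt : {set X}) (c L2 zeta : R) (T : nat) (pol : policy X).
Hypothesis SK : (#|Sopt| <= K)%N.
Hypothesis polP : bglm_ofu m c L2 zeta K T pol.
Local Notation rho := (conf_radius R X T).
Local Notation T0 := `|init_rounds m c L2 zeta T|%N.
Context (eta : R) (n L : nat).
Hypothesis eta0 : 0 < eta.
Hypothesis gap : forall S, expected_Y m S < expected_Y m Sopt ->
  expected_Y m S + slack * eta < expected_Y m Sopt.
Hypothesis n0 : (0 < n)%N.
Hypothesis neta : 4 * rho ^+ 2 <= n%:R * eta ^+ 2.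
Hypothesis TL : (T <= 2 ^ L)%N.

(** A round costs at most 1, and each indicator pays for one way optimism can fail: initialization,
    truth outside the region, an undersampled outcome. Otherwise [gap] forces an optimal play. *)
Lemma round_regret h : (size h < T)%N ->
  expected_Y m Sopt - expected_Y m (pol h) <=
  (size h < T0)%N%:R + \sum_x (rho ^+ 2 < deviation m x h)%R%:R +
  \sum_S \sum_(o | 0 < visit_prob m S o)
     ((pol h == S) && (nvisits S o h < n)%N)%:R.
Proof.
move=> hT.
set s1 := \sum_x _; set s2 := \sum_S _.
have s10 : 0 <= s1 by apply: sumr_ge0 => x _; exact: ler0n.
have s20 : 0 <= s2 by do 2 (apply: sumr_ge0 => ? _); exact: ler0n.
have rho0 : 0 <= rho by rewrite /conf_radius mulr_ge0// sqrtr_ge0.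
case: (ltP (expected_Y m (pol h)) (expected_Y m Sopt)) => [g|g]; last first.
  have : 0 <= (size h < T0)%N%:R :> R by exact: ler0n.
  by lra.
have g1 : expected_Y m Sopt - expected_Y m (pol h) <= 1.
  by have := expected_Y01 Sopt; have := expected_Y01 (pol h); lra.
case: (ltnP (size h) T0) => [_|hT0] /=; first by lra.
have [/existsP[x xdev]|nodev] := boolP [exists x, rho ^+ 2 < deviation m x h].
  have : 1 <= s1.
    by rewrite /s1 (bigD1 x)//= xdev lerDl; apply: sumr_ge0 => y _; exact: ler0n.
  by lra.
have dev x : deviation m x h <= rho ^+ 2.
  by move: nodev; rewrite negb_exists => /forallP/(_ x); rewrite -leNgt.
have [/existsP[y /andP[vy ov]]|novis] :=
    boolP [exists o, (0 < visit_prob m (pol h) o) && (nvisits (pol h) o h < n)%N].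
  have : 1 <= s2.
    rewrite /s2 (bigD1 (pol h))//= (bigD1 y)//= eqxx ov -addrA lerDl.
    apply: addr_ge0; first by apply: sumr_ge0 => ? _; exact: ler0n.
    by do 2 (apply: sumr_ge0 => ? _); exact: ler0n.
  by lra.
have vis o : 0 < visit_prob m (pol h) o -> (n <= nvisits (pol h) o h)%N.
  move: novis; rewrite negb_exists => /forallP/(_ o); rewrite negb_and => /orP[/negP//|].
  by rewrite -leqNgt.
have := polP hT; case: ifP => [hi|_].
  (* [T0] is the absolute value of the integer [init_rounds], hence an upper bound for it. *)
  exfalso; move: hT0; apply/negP; rewrite -ltnNge.
  rewrite -lez_nat abszE; apply: le_trans hi _; exact: ler_norm.
move=> [_ []] hat sc best.
have [|opt copt optP] := best _.
  by exists (true_tparams m); exact: truth_in_confidence.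
have := optimistic_round vm SK rho0 eta0 n0 neta sc dev copt optP vis.
by have := gap g; lra.
Qed.

Definition failure_bound : R :=
  expR (#|{: config}|%:R - 3 / 8 * rho ^+ 2) * (L.*2 + 3)%:R ^+ #|{: config}|.

Lemma regret_bound :
  \sum_(t < T) histE m pol t (fun h => expected_Y m Sopt - expected_Y m (pol h)) <=
  T0%:R + T%:R * (#|obs X|%:R * failure_bound) +
  \sum_S \sum_(o | 0 < visit_prob m S o) n%:R / visit_prob m S o.
Proof.
have step (t : 'I_T) : histE m pol t (fun h => expected_Y m Sopt - expected_Y m (pol h)) <=
    (t < T0)%N%:R + #|obs X|%:R * failure_bound +
    \sum_S \sum_(o | 0 < visit_prob m S o)
      histE m pol t (fun h => ((pol h == S) && (nvisits S o h < n)%N)%:R).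
  pose F1 (h : history X) : R := \sum_x (rho ^+ 2 < deviation m x h)%R%:R.
  pose F2 (h : history X) : R := \sum_S \sum_(o | 0 < visit_prob m S o)
     ((pol h == S) && (nvisits S o h < n)%N)%:R.
  apply: (@le_trans _ _ (histE m pol t (fun h => ((t < T0)%N%:R + F1 h) + F2 h))).
    by apply: ler_histE => h ht; rewrite -[in (t < T0)%N]ht; apply: round_regret; rewrite ht.
  rewrite histED histED histE_cst; apply: lerD; first apply: lerD => //.
    rewrite /F1 histE_sum mulr_natl -sumr_const.
    apply: ler_sum => x _; apply: (deviation_prob vm).
    by apply: leq_trans TL; exact: ltnW.
  rewrite /F2 histE_sum; apply: ler_sum => S _.
  by rewrite histE_sum.
apply: (le_trans (ler_sum _ (fun t _ => step t))).
rewrite !big_split/=; apply: lerD; first apply: lerD; last first.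
- rewrite exchange_big/=; apply: ler_sum => S _.
  rewrite exchange_big/=; apply: ler_sum => o vo.
  rewrite ler_pdivlMr// big_distrl/=; exact: nvisits_bound.
- by rewrite sumr_const card_ord -[leLHS]mulr_natl.
- rewrite -natr_sum ler_nat -(big_mkord xpredT (fun t => (t < T0)%N : nat)).
  have H k : (\sum_(0 <= t < k) (t < T0) = minn k T0)%N.
    elim: k => [|k IH]; first by rewrite big_nil min0n.
    by rewrite big_nat_recr//= IH; lia.
  by rewrite H geq_minr.
Qed.

End RegretBound.

(** * Growth in the horizon *)

Lemma poly_le_expR {R : realType} (A : R) (k : nat) :
  exists2 l0 : R, 1 <= l0 & forall l, l0 <= l -> A * l ^+ k <= expR (l / 2).
Proof.
(* The term of degree [k.+1] in the series of exp(l/2) is [l ^+ k.+1 / B], which dominates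
   [A * l ^+ k] once [l >= A * B]. *)
pose B : R := 2 ^+ k.+1 * k.+1`!%:R.
have B0 : 0 < B by rewrite mulr_gt0 ?exprn_gt0// ltr0n fact_gt0.
exists (Num.max 1 (A * B)); first by rewrite le_max lexx.
move=> l; rewrite ge_max => /andP[l1 lA].
have l0 : 0 <= l by lra.
have := @expR_ge1Dxn R (l / 2) k; rewrite divr_ge0// => /(_ isT).
apply: le_trans; rewrite -[leLHS]add0r; apply: lerD => //.
rewrite expr_div_n -mulrA -invfM -/B ler_pdivlMr// exprS mulrAC.
by apply: ler_wpM2r => //; exact: exprn_ge0.
Qed.

Section Asymptotics.
Context {R : realType} {d} {Omega : measurableType d} {P : probability Omega R}.
Context {U X : finType} (m : blm P U X).

Local Notation loginv T := (ln (conf_delta R X T)^-1).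

Lemma sqrt_expR T : (0 < T)%N -> Num.sqrt T%:R = expR (ln T%:R / 2) :> R.
Proof.
move=> T0; have T0' : 0 < T%:R :> R by rewrite ltr0n.
have E : T%:R = expR (ln T%:R / 2) ^+ 2 :> R by rewrite -expRM_natr divfK// lnK.
by rewrite [in LHS]E sqrtr_sqr ger0_norm ?expR_ge0.
Qed.

Lemma loginvE T : (0 < T)%N -> loginv T = ln (3 * (tnum X)%:R) + ln T%:R / 2.
Proof.
move=> T0; rewrite /conf_delta invrK sqrt_expR//.
have n0 : 0 < 3 * (tnum X)%:R :> R by rewrite mulr_gt0// ltr0n /tnum card_option.
by rewrite [LHS]lnM ?posrE ?expR_gt0// expRK.
Qed.

Lemma tnum_ln_ge0 : 0 <= ln (3 * (tnum X)%:R) :> R.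
Proof. by apply: ln_ge0; rewrite -natrM ler1n muln_gt0 /tnum card_option. Qed.

Lemma conf_radius_sq T : (0 < T)%N -> conf_radius R X T ^+ 2 = 9 * loginv T.
Proof.
move=> T0; rewrite /conf_radius exprMn sqr_sqrtr; first by congr (_ * _); ring.
rewrite loginvE// addr_ge0 ?tnum_ln_ge0// divr_ge0// ln_ge0//.
by rewrite ler1n.
Qed.

Lemma absz_ceil_le (y : R) : (`|Num.ceil y|%N)%:R <= `|y| + 1.
Proof.
rewrite natr_absz intr_norm ler_norml.
have h1 := ceil_ge y; have h2 := ceilB1_lt y.
rewrite intrB in h2.
have := ler_norm y; have := ler_norm (- y); rewrite normrN; lra.
Qed.

Lemma loginv_bounds T : (0 < T)%N -> 1 <= ln T%:R :> R ->
  ln T%:R / 2 <= loginv T <= (ln (3 * (tnum X)%:R) + 1) * ln T%:R.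
Proof. by move=> T0 l1; rewrite loginvE//; have := tnum_ln_ge0; nra. Qed.

Lemma init_rounds_log (c L2 zeta : R) :
  exists A : R, forall T, (0 < T)%N -> 1 <= ln T%:R :> R ->
  (`|init_rounds m c L2 zeta T|%N)%:R <= A * ln T%:R.
Proof.
pose a : R := ln (3 * (tnum X)%:R) + 1.
pose D : R := (tdeg m)%:R.
pose q : R := (8 * (tnum X)%:R ^+ 2 - 16 * (tnum X)%:R + 2) / zeta.
pose e : R := `|512 * D * L2 ^+ 2|.
exists (`|c / zeta ^+ 2| * a + `|q| * (e * (D ^+ 2 + a) + 1) + 1) => T T0 l1.
have /andP[lam0 lam1] := loginv_bounds T0 l1; rewrite -/a in lam1.
set l := ln T%:R in l1 lam0 lam1 *; set lam := loginv T in lam0 lam1.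
have lam_ge0 : 0 <= lam by lra.
have a0 : 0 <= a by have := tnum_ln_ge0; rewrite /a; lra.
have q0 := normr_ge0 q; have e0 : 0 <= e by exact: normr_ge0.
have me : `|min_eig m L2 T| <= (e * (D ^+ 2 + a) + 1) * l.
  rewrite /min_eig -intr_norm -natr_absz; apply: le_trans (absz_ceil_le _) _.
  rewrite normrM -/D -/e -/lam ger0_norm ?addr_ge0 ?sqr_ge0//.
  have D0 : 0 <= D ^+ 2 * (l - 1) by rewrite mulr_ge0 ?sqr_ge0//; lra.
  have h : D ^+ 2 + lam <= (D ^+ 2 + a) * l.
    have -> : (D ^+ 2 + a) * l = D ^+ 2 * (l - 1) + (D ^+ 2 + a * l) by ring.
    by apply: le_trans (lerD (lexx _) lam1) _; rewrite lerDr.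
  have {}h := ler_wpM2l e0 h.
  by rewrite [leRHS]mulrDl mul1r -mulrA lerD.
rewrite /init_rounds; apply: le_trans (absz_ceil_le _) _.
set y1 := c / _ * _; set y2 := _ / zeta.
have y1P : `|y1| <= `|c / zeta ^+ 2| * a * l.
  by rewrite /y1 normrM -/lam (ger0_norm lam_ge0) -mulrA ler_wpM2l.
have y2P : `|y2| <= `|q| * ((e * (D ^+ 2 + a) + 1) * l).
  rewrite /y2 mulrAC normrM -/q; exact: ler_wpM2l.
have : `|Num.max y1 y2| <= `|y1| + `|y2|.
  by have n1 := normr_ge0 y1; have n2 := normr_ge0 y2; have [_|_] := leP y1 y2; lra.
by move=> n12; lra.
Qed.

Lemma failure_bound_log : exists A : R, forall T, (0 < T)%N -> 1 <= ln T%:R :> R ->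
  T%:R * (#|obs X|%:R * @failure_bound R X T (up_log 2 T)) <=
  A * ln T%:R ^+ #|{: {ffun obs X -> bool}}| :> R.
Proof.
set q := #|{: {ffun obs X -> bool}}|.
have ln2 : 0 < ln 2 :> R by apply: ln_gt0; lra.
(* The grid has 2 [up_log 2 T] + 3 points, with [up_log 2 T] at most l / ln 2 + 1; constants are
   absorbed by [l >= 1]. *)
pose b : R := 2 / ln 2 + 5.
exists (#|obs X|%:R * (expR q%:R * b ^+ q)) => T T0 l1.
set l := ln T%:R in l1 *.
have T0' : 0 < T%:R :> R by rewrite ltr0n.
have b0 : 0 <= b by rewrite addr_ge0// divr_ge0// ltW.
have /andP[lam0 _] := loginv_bounds T0 l1; rewrite -/l in lam0.
have grid_le : ((up_log 2 T).*2 + 3)%:R <= b * l.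
  have up : (up_log 2 T)%:R <= l / ln 2 + 1.
    have T1 : (1 < T)%N.
      rewrite ltn_neqAle T0 andbT; apply/eqP => TE.
      by move: l1; rewrite /l -TE ln1; lra.
    have /andP[h _] := up_log_bounds (isT : 1 < 2)%N T1.
    have u0 : (0 < up_log 2 T)%N by rewrite up_log_gt0.
    have : ln ((2 ^ (up_log 2 T).-1)%:R) <= l.
      rewrite ler_ln ?posrE ?ltr0n ?expn_gt0//.
      by rewrite ler_nat ltnW.
    rewrite natrX lnXn// => h1.
    have : (up_log 2 T).-1%:R <= l / ln 2 by rewrite ler_pdivlMr// mulr_natl.
    by rewrite -{2}(prednK u0) -[in X in _ -> X]natr1; lra.
  have E : b * l = 2 * (l / ln 2) + 5 * l by rewrite /b; ring.
  by rewrite natrD -mul2n natrM; lra.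
(* The squared radius is at least (9/2) ln T, and 3/8 of it exceeds ln T; this gain of 1/T offsets
   the number of rounds. *)
have expb : expR (q%:R - 3 / 8 * conf_radius R X T ^+ 2) <= expR q%:R / T%:R.
  rewrite -[T%:R in leRHS]lnK// -expRN -expRD ler_expR conf_radius_sq//.
  by rewrite -/l; lra.
rewrite /failure_bound -/q mulrCA -[leRHS]mulrA; apply: ler_wpM2l; first exact: ler0n.
have : expR (q%:R - 3 / 8 * conf_radius R X T ^+ 2) * ((up_log 2 T).*2 + 3)%:R ^+ q <=
   expR q%:R / T%:R * (b * l) ^+ q.
  apply: ler_pM => //.
  by apply: lerXn2r => //; rewrite nnegrE// mulr_ge0//; lra.
move=> h; apply: (le_trans (ler_wpM2l (ltW T0') h)).
by rewrite mulrA [T%:R * _]mulrC divfK ?gt_eqF// exprMn mulrA.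
Qed.

Lemma nplays_log (eta : R) : 0 < eta ->
  exists A : R, forall T, (0 < T)%N -> 1 <= ln T%:R :> R ->
  (Num.truncn (4 * conf_radius R X T ^+ 2 / eta ^+ 2)).+1%:R <= A * ln T%:R.
Proof.
move=> eta0; pose a : R := ln (3 * (tnum X)%:R) + 1.
exists (36 / eta ^+ 2 * a + 1) => T T0 l1.
have /andP[lam0 lam1] := loginv_bounds T0 l1; rewrite -/a in lam1.
have e2 : 0 < eta ^+ 2 by rewrite exprn_gt0.
rewrite -addn1 natrD [leRHS]mulrDl mul1r; apply: lerD => //.
apply: (@le_trans _ _ (4 * conf_radius R X T ^+ 2 / eta ^+ 2)).
  by rewrite truncn_le divr_ge0 ?mulr_ge0 ?sqr_ge0// ltW.
rewrite conf_radius_sq//.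
have -> : 4 * (9 * loginv T) / eta ^+ 2 = 36 / eta ^+ 2 * loginv T by ring.
by rewrite -[leRHS]mulrA; apply: ler_wpM2l => //; rewrite divr_ge0// ltW.
Qed.

End Asymptotics.

Theorem theorem2 (R : realType) :
  exists2 C : R, 0 < C &
  forall (d : measure_display) (Omega : measurableType d)
    (P : probability Omega R) (U X : finType) (G : blm P U X)
    (K : nat) (Sopt : {set X}) (zeta c L2 : R),
  valid_blm G ->
  is_optimal G K Sopt ->
  0 < zeta -> assumption3 G zeta ->
  0 < c -> lecue_mendelson c ->
  0 < L2 ->
  exists T1 : nat, forall T : nat, (T1 <= T)%N ->
  forall pol : policy X, bglm_ofu G c L2 zeta K T pol ->
  (regret G Sopt pol T <=
   (C * (tnum X)%:R * Num.sqrt ((tdeg G)%:R * T%:R) * ln T%:R)%:E)%E.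
Proof.
(* Any positive constant would do: the regret is shown to be eventually at most [sqrt T]. *)
exists 1; first exact: ltr01.
move=> d Omega P U X G K Sopt zeta c L2 vm [SoptK _] _ _ _ _ _.
pose N : nat := #|obs X|.
pose slack : R := (N%:R + 2) ^+ N.+1.
have slack0 : 0 < slack by rewrite exprn_gt0// ltr_wpDl.
have [eta' eta'0 sep] := pos_separation (fun S => expected_Y G Sopt - expected_Y G S).
(* Half of nothing is lost here: the amplification [slack] of [sigma'_close] turns the prediction
   error [eta] into exactly [eta'], which is below every positive suboptimality gap. *)
pose eta := eta' / slack.
have eta0 : 0 < eta by rewrite divr_gt0.
have gap S : expected_Y G S < expected_Y G Sopt ->
    expected_Y G S + slack * eta < expected_Y G Sopt.
  by rewrite -subr_gt0 => /sep; rewrite /eta mulrC divfK ?gt_eqF//; lra.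
have [A1 HA1] := init_rounds_log G c L2 zeta.
have [A2] := @failure_bound_log R X; move: #|{: {ffun obs X -> bool}}| => q HA2.
have [A3 HA3] := @nplays_log R X eta eta0.
pose w : R := \sum_S \sum_(o | 0 < visit_prob G S o) (visit_prob G S o)^-1.
(* The three parts of the regret bound grow like the powers 1, [q] and 1 of ln T, all dominated by
   the power [q.+1]. *)
have [l0 l01 Hl0] := poly_le_expR (`|A1| + `|A2| + `|A3 * w|) q.+1.
exists (Num.truncn (expR l0)).+1 => T T1T pol polP.
have eT : expR l0 <= T%:R.
  by apply: ltW; apply: lt_le_trans (truncnS_gt _) _; rewrite ler_nat.
have T0 : (0 < T)%N by apply: leq_trans T1T.
have T0' : 0 < T%:R :> R by rewrite ltr0n.
set l : R := ln T%:R.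
have l0l : l0 <= l by rewrite -[l0]expRK ler_ln// posrE expR_gt0.
have l1 : 1 <= l by exact: le_trans l01 l0l.
pose n := (Num.truncn (4 * conf_radius R X T ^+ 2 / eta ^+ 2)).+1.
have neta : 4 * conf_radius R X T ^+ 2 <= n%:R * eta ^+ 2.
  rewrite -ler_pdivrMr ?exprn_gt0//; apply: ltW; exact: truncnS_gt.
rewrite regretE// lee_fin.
have SK : (#|Sopt| <= K)%N by rewrite SoptK.
have TL : (T <= 2 ^ up_log 2 T)%N by exact: up_logP.
apply: le_trans (regret_bound vm SK polP eta0 gap (ltn0Sn _) neta TL) _.
have h1 := HA1 T T0 l1; have h2 := HA2 T T0 l1; have h3 := HA3 T T0 l1.
have w0 : 0 <= w by do 2 (apply: sumr_ge0 => ? ?); rewrite invr_ge0 ltW.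
have h4 : \sum_S \sum_(o | 0 < visit_prob G S o) n%:R / visit_prob G S o <= A3 * w * l.
  have -> : \sum_S \sum_(o | 0 < visit_prob G S o) n%:R / visit_prob G S o = n%:R * w.
    by rewrite /w big_distrr; apply: eq_bigr => S _; rewrite big_distrr.
  by rewrite mulrAC; exact: ler_wpM2r.
have lpow k (B : R) : (k <= q.+1)%N -> B * l ^+ k <= `|B| * l ^+ q.+1.
  move=> kq; apply: le_trans (ler_wpM2r _ (ler_norm B)) _.
    by rewrite exprn_ge0// (le_trans ler01).
  by rewrite ler_wpM2l// ler_weXn2l.
have h5 := lpow 1%N A1 isT; have h6 := lpow q A2 (leqnSn _); have h7 := lpow 1%N (A3 * w) isT.
rewrite expr1 in h5 h7.
have h8 := Hl0 l l0l.
(* This intermediate value is [sqrt T]; the remaining factors of the target are all at least 1. *)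
apply: (@le_trans _ _ (expR (l / 2))).
  apply: le_trans h8; rewrite !(mulrDl _ _ (l ^+ _)); rewrite -/l in h1 h2.
  apply: lerD; last exact: le_trans h4 h7.
  by apply: lerD; [exact: le_trans h1 h5|exact: le_trans h2 h6].
rewrite -sqrt_expR// mul1r sqrtrM ?ler0n//.
have n1 : 1 <= (tnum X)%:R :> R by rewrite ler1n /tnum card_option.
have D1 : 1 <= Num.sqrt (tdeg G)%:R :> R.
  rewrite -[leLHS]sqrtr1 ler_sqrt ?ler0n// ler1n /tdeg.
  apply: leq_trans (leq_bigmax None); apply/card_gt0P; exists None.
  by rewrite inE.
have sT := sqrtr_ge0 (T%:R : R).
have sD := ler_peMl sT D1.
have sDn := le_trans sD (ler_peMl (le_trans sT sD) n1).
exact: le_trans sDn (ler_peMr (le_trans sT sDn) l1).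
Qed.
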